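(* Let $T\in\mathfrak{E}_1(H)$, let $\omega$ be its curvature function, and let $M$ be the Weyl function of $T$ with respect to a boundary triplet $(\mathbb{C},\Gamma_0,\Gamma_1)$. Then for $u\in\mathbb{R}$, $$\omega(u)=\frac16(\mathcal{S}M)(u),\qquad (\mathcal{S}M)(u):=\Big(\frac{M''(u)}{M'(u)}\Big)'-\frac12\Big(\frac{M''(u)}{M'(u)}\Big)^2,$$ where at the (real, simple) poles of $M$ the Schwarzian derivative $\mathcal{S}M$ is understood through its removable singularity.
   Context: Entire operators. $H$ denotes a separable infinite-dimensional complex Hilbert space (inner products are linear in the first variable). A symmetric operator $T$ in $H$ is a linear operator on a subspace $D(T)\subset H$, not necessarily dense, with $(Tx,y)=(x,Ty)$ for all $x,y\in D(T)$; it is always assumed closed. $T$ is simple if it has no nontrivial self-adjoint part as an orthogonal direct summand. On $\mathbb{H}=H\oplus H$ put $[x,y]_c=(x_2,y_1)_H-(x_1,y_2)_H$ for $x=(x_1,x_2)$, $y=(y_1,y_2)$. Let $A_T\subset\mathbb{H}$ be the graph of $T$, $A_T^{\bot_s}=\{x\in\mathbb{H}: [x,y]_c=0\ \forall y\in A_T\}\supset A_T$, and $\mathcal{B}_T=A_T^{\bot_s}/A_T$ with the induced form $[\cdot,\cdot]_q$. The signature of $-\mathrm{i}[\cdot,\cdot]_q$ is the pair of deficiency indices of $T$, assumed to be $(1,1)$. $T$ is called regular (equivalently: entire) if for every $\lambda\in\mathbb{C}$ there is $c_\lambda>0$ with $\|(T-\lambda)x\|\ge c_\lambda\|x\|$ for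 all $x\in D(T)$. $\mathfrak{E}_1(H)$ is the set of closed simple symmetric entire operators in $H$ with deficiency indices $(1,1)$. Boundary triplets and Weyl functions. A boundary triplet $(\mathbb{C},\Gamma_+,\Gamma_-)$ for $T$ consists of linear maps $\Gamma_\pm:A_T^{\bot_s}\to\mathbb{C}$ vanishing on $A_T$, such that $(\Gamma_+,\Gamma_-)$ induces an isomorphism $\mathcal{B}_T\to\mathbb{C}^2$ and $[x,y]_c=\mathrm{i}\,\Gamma_+x\,\overline{\Gamma_+y}-\mathrm{i}\,\Gamma_-x\,\overline{\Gamma_-y}$. The associated boundary triplet $(\mathbb{C},\Gamma_0,\Gamma_1)$ is $\Gamma_0=\frac{\Gamma_+-\Gamma_-}{\mathrm{i}\sqrt2}$, $\Gamma_1=\frac{\Gamma_++\Gamma_-}{\sqrt2}$, so that $[x,y]_c=\Gamma_1x\,\overline{\Gamma_0y}-\Gamma_0x\,\overline{\Gamma_1y}$. With $W_\lambda=\{(x,\lambda x):x\in H\}\cap A_T^{\bot_s}$ (one-dimensional), for $\Im\lambda>0$ the contractive Weyl function $B$ and the Weyl function $M$ are defined by $\Gamma_-a=B(\lambda)\Gamma_+a$ and $\Gamma_1a=M(\lambda)\Gamma_0a$ for $a\in W_\lambda$; thus $B=(M-\mathrm{i})/(M+\mathrm{i})$, and both extend meromorphically to $\mathbb{C}$. $|B|<1$ and $\Im M>0$ on the upper half-plane, $|B|=1$ on $\mathbb{R}$, $B(\lambda)\overline{B(\bar\lambda)}\equiv1$, and $M$ is real on $\mathbb{R}$ off its poles,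 all of which are real and simple. Curvature function. The curvature function of $T$ is the real-analytic function $\omega$ on $\mathbb{C}$ given off the real line by $$\omega(\lambda)=\frac{1}{4(\Im\lambda)^2}-\frac{|B'(\lambda)|^2}{(1-|B(\lambda)|^2)^2}$$ (with $\omega(\bar\lambda)=\omega(\lambda)$), and extended real-analytically across $\mathbb{R}$; it does not depend on the choice of boundary triplet. *)

(* Defs.v *)
From Stdlib Require Export Reals.
From Coquelicot Require Export Coquelicot.

Open Scope R_scope.

(** * Hilbert spaces *)

Record HilbertSpace := {
  hilbert_carrier :> CompleteNormedModule C_AbsRing;
  inner : hilbert_carrier -> hilbert_carrier -> C;
  inner_plus_l : forall x y z, inner (plus x y) z = (inner x z + inner y z)%C;
  inner_scal_l : forall (c : C) x y, inner (scal c x) y = (c * inner x y)%C;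
  inner_conj : forall x y, inner y x = Cconj (inner x y);
  (* Positive definiteness follows from [norm_eq_zero]; completeness is that
     of the carrier. *)
  inner_norm : forall x, inner x x = RtoC (norm x * norm x)
}.

Arguments inner {_} _ _.

Definition separable (H : HilbertSpace) : Prop :=
  exists s : nat -> H, forall (x : H) (eps : posreal),
    exists n, norm (minus (s n) x) < eps.

(* No finite family [e 0, ..., e n] spans. *)
Definition infinite_dimensional (H : HilbertSpace) : Prop :=
  forall (n : nat) (e : nat -> H), exists x : H,
    forall c : nat -> C, x <> sum_n (fun i => scal (c i) (e i)) n.

Definition is_subspace {V : ModuleSpace C_Ring} (L : V -> Prop) : Prop :=
  L zero /\ (forall x y, L x -> L y -> L (plus x y)) /\
  (forall (c : C) x, L x -> L (scal c x)).

Definition is_linear_on {V W : ModuleSpace C_Ring} (L : V -> Prop) (f : V -> W)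
  : Prop :=
  (forall x y, L x -> L y -> f (plus x y) = plus (f x) (f y)) /\
  (forall (c : C) x, L x -> f (scal c x) = scal c (f x)).

Definition orth {H : HilbertSpace} (L : H -> Prop) (x : H) : Prop :=
  forall y, L y -> inner x y = RtoC 0.

(** * Symmetric operators *)

(* The values of [op] outside [dom] are irrelevant. *)
Record operator (H : HilbertSpace) := {
  dom : H -> Prop;
  op :> H -> H;
  dom_subspace : is_subspace dom;
  op_linear : is_linear_on dom op
}.

Arguments dom {_} _ _.
Arguments op {_} _ _.

Definition graph {H : HilbertSpace} (T : operator H) (x : H * H) : Prop :=
  dom T (fst x) /\ snd x = T (fst x).

Definition is_symmetric {H : HilbertSpace} (T : operator H) : Prop :=
  forall x y, dom T x -> dom T y -> inner (T x) y = inner x (T y).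

Definition is_closed {H : HilbertSpace} (T : operator H) : Prop :=
  closed (graph T).

(* [T] is the orthogonal sum of its parts in [L] and in the orthogonal
   complement of [L]. *)
Definition reduces {H : HilbertSpace} (L : H -> Prop) (T : operator H) : Prop :=
  is_subspace L /\ closed L /\
  forall x, dom T x -> exists y z, x = plus y z /\
    dom T y /\ L y /\ L (T y) /\
    dom T z /\ orth L z /\ orth L (T z).

(* The part of [T] in [L], as an operator in the Hilbert space [L], is densely
   defined and coincides with its adjoint. *)
Definition self_adjoint_part {H : HilbertSpace} (L : H -> Prop) (T : operator H)
  : Prop :=
  (forall x (eps : posreal), L x ->
     exists y, dom T y /\ L y /\ norm (minus y x) < eps) /\
  (forall x w, L x -> L w ->
     ((dom T x /\ T x = w) <->
      (forall y, dom T y -> L y -> inner (T y) x = inner y w))).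

Definition is_simple {H : HilbertSpace} (T : operator H) : Prop :=
  forall L : H -> Prop, reduces L T -> self_adjoint_part L T ->
    forall x, L x -> x = zero.

Definition is_regular {H : HilbertSpace} (T : operator H) : Prop :=
  forall lambda : C, exists c : R, 0 < c /\
    forall x, dom T x -> c * norm x <= norm (minus (T x) (scal lambda x)).

(** * Boundary form and deficiency indices *)

Definition cform {H : HilbertSpace} (x y : H * H) : C :=
  (inner (snd x) (fst y) - inner (fst x) (snd y))%C.

Definition graph_orth {H : HilbertSpace} (T : operator H) (x : H * H) : Prop :=
  forall y, graph T y -> cform x y = RtoC 0.

(* The form [-i [.,.]_q] induced on the quotient [graph_orth T / graph T] has
   signature (1,1): the classes of [e] and [f] form a basis of the quotient in
   which the form is diag(1,-1).  Independence of the classes follows from the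
   values of the form, which vanishes on [graph T]. *)
Definition deficiency_indices_1_1 {H : HilbertSpace} (T : operator H) : Prop :=
  exists e f : H * H,
    graph_orth T e /\ graph_orth T f /\
    (- Ci * cform e e = RtoC 1)%C /\
    (- Ci * cform f f = RtoC (-1))%C /\
    (- Ci * cform e f = RtoC 0)%C /\
    forall x, graph_orth T x -> exists (a b : C) (t : H * H),
      graph T t /\ x = plus (plus (scal a e) (scal b f)) t.

Record entire_1_1 {H : HilbertSpace} (T : operator H) : Prop := {
  entire_symmetric : is_symmetric T;
  entire_closed : is_closed T;
  entire_simple : is_simple T;
  entire_regular : is_regular T;
  entire_deficiency : deficiency_indices_1_1 T
}.

(** * Boundary triplets *)

(* Only the values of [Gp] and [Gm] on [graph_orth T] matter. *)
Record boundary_triplet {H : HilbertSpace} (T : operator H)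
  (Gp Gm : H * H -> C) : Prop := {
  triplet_linear_p : is_linear_on (graph_orth T) Gp;
  triplet_linear_m : is_linear_on (graph_orth T) Gm;
  triplet_vanish : forall x, graph T x -> Gp x = RtoC 0 /\ Gm x = RtoC 0;
  triplet_inj : forall x, graph_orth T x ->
    Gp x = RtoC 0 -> Gm x = RtoC 0 -> graph T x;
  triplet_surj : forall a b : C, exists x, graph_orth T x /\ Gp x = a /\ Gm x = b;
  triplet_green : forall x y, graph_orth T x -> graph_orth T y ->
    cform x y = (Ci * Gp x * Cconj (Gp y) - Ci * Gm x * Cconj (Gm y))%C
}.

Definition Gamma0 {X : Type} (Gp Gm : X -> C) (x : X) : C :=
  ((Gp x - Gm x) / (Ci * RtoC (sqrt 2)))%C.

Definition Gamma1 {X : Type} (Gp Gm : X -> C) (x : X) : C :=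
  ((Gp x + Gm x) / RtoC (sqrt 2))%C.

Definition Wspace {H : HilbertSpace} (T : operator H) (lambda : C) (a : H * H)
  : Prop :=
  graph_orth T a /\ snd a = scal lambda (fst a).

(** * Analytic, meromorphic and real-analytic functions *)

Definition analytic_at (f : C -> C) (z0 : C) : Prop :=
  exists a : nat -> C,
    locally z0 (fun z : C =>
      is_pseries (K := C_AbsRing) (V := C_NormedModule) a (z - z0)%C (f z)).

(* The value of [f] at the pole itself is unconstrained. *)
Definition is_pole (f : C -> C) (z0 : C) : Prop :=
  exists (n : nat) (g : C -> C),
    (0 < n)%nat /\ analytic_at g z0 /\ g z0 <> RtoC 0 /\
    locally' z0 (fun z : C => f z = (g z / (z - z0) ^ n)%C).

Definition meromorphic (f : C -> C) : Prop :=
  forall z0 : C, analytic_at f z0 \/ is_pole f z0.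

(* Absolutely convergent expansion in two real variables, grouped by degree. *)
Definition real_analytic (f : C -> R) : Prop :=
  forall z0 : C, exists (a : nat -> nat -> R) (r : R), 0 < r /\
    forall h k : R, Rabs h < r -> Rabs k < r ->
      ex_series (fun n => sum_n (fun i =>
        Rabs (a i (n - i)%nat * h ^ i * k ^ (n - i))) n) /\
      is_series (fun n => sum_n (fun i =>
        a i (n - i)%nat * h ^ i * k ^ (n - i)) n) (f (fst z0 + h, snd z0 + k)).

(** * Weyl functions, curvature and the Schwarzian derivative *)

Definition contractive_weyl_function {H : HilbertSpace} (T : operator H)
  (Gp Gm : H * H -> C) (B : C -> C) : Prop :=
  meromorphic B /\
  forall (lambda : C) (a : H * H), 0 < Im lambda -> Wspace T lambda a ->
    Gm a = (B lambda * Gp a)%C.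

Definition weyl_function {H : HilbertSpace} (T : operator H)
  (Gp Gm : H * H -> C) (M : C -> C) : Prop :=
  meromorphic M /\
  forall (lambda : C) (a : H * H), 0 < Im lambda -> Wspace T lambda a ->
    Gamma1 Gp Gm a = (M lambda * Gamma0 Gp Gm a)%C.

(* The symmetry prescribes [omega] in the lower half-plane (where [B] may have
   poles), and real-analyticity prescribes it on the real line.  The triplet
   used is unrelated to any other one. *)
Definition curvature_function {H : HilbertSpace} (T : operator H)
  (omega : C -> R) : Prop :=
  real_analytic omega /\
  (forall lambda : C, omega (Cconj lambda) = omega lambda) /\
  exists (Gp Gm : H * H -> C) (B : C -> C),
    boundary_triplet T Gp Gm /\ contractive_weyl_function T Gp Gm B /\
    forall lambda : C, 0 < Im lambda ->
      omega lambda =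
        1 / (4 * (Im lambda) ^ 2)
        - (Cmod (C_derive B lambda)) ^ 2 / (1 - (Cmod (B lambda)) ^ 2) ^ 2.

Definition schwarzian (f : C -> C) (z : C) : C :=
  let N := fun w : C => (C_derive (C_derive f) w / C_derive f w)%C in
  (C_derive N z - / RtoC 2 * (N z * N z))%C.

(* Main.v *)
Require Import Defs.
From Stdlib Require Import Lra Lia Classical ClassicalEpsilon.

(** Near a real point [u] the curvature formula only involves the contractive
    Weyl function [B], so the claim splits into three facts about [B].

    The first fact is [curvature_limit], a Taylor computation: if [B] is
    analytic at [u], unimodular on the real line near [u], and [B'(u) <> 0],
    then the expression defining the curvature tends to one sixth of the
    Schwarzian derivative of [B] at [u] along [u + i y], [y -> 0+].  After
    multiplication by the conjugate of [B(u)] the expansion is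
    [1 + e1 h + e2 h^2 + e3 h^3 + O(h^4)], and unimodularity on the real line
    determines the real parts of [e1], [e2], [e3] from the imaginary parts.
    The double poles in [y] cancel, and what is left is
    [e3/e1 - (e2/e1)^2].  As [omega] is continuous, this limit is [omega(u)].

    The second fact is that [B] has these properties.  For [a = (x, lambda x)]
    in [W_lambda], Green's identity reads
    [(1 - |B(lambda)|^2) |Gamma_+ a|^2 = 2 Im(lambda) |x|^2].  Here [Gamma_+] is
    bounded by the norm of [x], because [Gamma_+ a] is a value of the boundary
    form; conversely regularity of [T] at [u] bounds the norm of [x] by
    [Gamma_+ a] for [lambda] near [u], because otherwise [T - u] would have
    approximate eigenvectors.  So [1 - |B|^2] lies between two positive
    multiples of [Im(lambda)]
    ([contractive_lower_bound], [contractive_upper_bound]).  The upper bound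
    gives [|B| = 1] on the real line and excludes a pole, the lower one gives
    [B'(u) <> 0].  Nonzero vectors in [W_lambda] exist, by
    [weyl_vector_exists]: otherwise the range of [T - conj(lambda)] would be
    all of [H], and a boundary vector on which the form is positive could be
    moved into [W_(conj lambda)], where the form is nonpositive.

    The third fact relates [B] to [M], which belongs to another boundary
    triplet.  The boundary maps of two triplets differ by an invertible 2 x 2
    matrix, so [M] is a Moebius transform of [B] in the upper half-plane
    ([weyl_mobius]).  By the identity theorem for power series this remains
    true in a neighbourhood of [u], without [u] itself if [u] is a pole of [M].
    The Schwarzian derivative is Moebius invariant ([schwarzian_mobius]); hence
    that of [M] coincides near [u] with that of [B], which is continuous at [u]. *)

(** * Complex derivatives *)

(** [C] is a normed module over itself in two ways; this is the structure for
    which [is_C_derive_unique] links derivatives to [C_derive]. *)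
Definition cderive (f : C -> C) (z l : C) : Prop :=
  @is_derive C_AbsRing C_NormedModule f z l.

(** The two module structures have the same norm, so only the linearity record
    has to be rebuilt.  The product and chain rules live in the other structure. *)
Lemma cderive_abs_ring f z l :
  cderive f z l <-> @is_derive C_AbsRing (AbsRing_NormedModule C_AbsRing) f z l.
Proof.
  split; intros [[H1 H2 H3] H]; (split; [now split | exact H]).
Qed.

Lemma cderive_plus f g z a b :
  cderive f z a -> cderive g z b -> cderive (fun w => f w + g w)%C z (a + b)%C.
Proof. exact (is_derive_plus f g z a b). Qed.

Lemma cderive_mult f g z a b :
  cderive f z a -> cderive g z b ->
  cderive (fun w => f w * g w)%C z (a * g z + f z * b)%C.
Proof.
  rewrite !cderive_abs_ring. intros Hf Hg.
  exact (is_derive_mult (K := C_AbsRing) f g z a b Hf Hg Cmult_comm).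
Qed.

Lemma cderive_const c z : cderive (fun _ => c) z (RtoC 0).
Proof. exact (is_derive_const (K := C_AbsRing) (V := C_NormedModule) c z). Qed.

Lemma cderive_comp f g z a b :
  cderive f (g z) a -> cderive g z b -> cderive (fun w => f (g w)) z (b * a)%C.
Proof.
  rewrite (cderive_abs_ring g).
  exact (is_derive_comp (K := C_AbsRing) (V := C_NormedModule) f g z a b).
Qed.

Lemma cderive_ext_near f g z l r :
  0 < r -> (forall w, Cmod (w - z) < r -> f w = g w) ->
  cderive f z l -> cderive g z l.
Proof.
  intros Hr H Hf.
  apply (is_derive_ext_loc (K := C_AbsRing) (V := C_NormedModule) f g z l); trivial.
  exists (mkposreal r Hr). exact H.
Qed.

(** Source of the derivatives of power series and of the inverse, whose Taylor
    remainders both satisfy a quadratic bound. *)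
Lemma cderive_quadratic f z l r K :
  0 < r ->
  (forall w, Cmod (w - z) < r ->
     Cmod (f w - f z - (w - z) * l) <= K * Cmod (w - z) ^ 2) ->
  cderive f z l.
Proof.
  intros Hr H. split.
  - exact (is_linear_scal_l (K := C_AbsRing) (V := C_NormedModule) l).
  - intros x Hx. assert (x = z) as -> by (symmetry; now apply @is_filter_lim_locally_unique).
    intros eps.
    assert (HK : 0 < Rabs K + 1) by (pose proof (Rabs_pos K); lra).
    assert (Hd : 0 < Rmin r (eps / (Rabs K + 1))).
    { apply Rmin_pos; trivial. apply Rdiv_lt_0_compat; trivial. apply eps. }
    exists (mkposreal _ Hd). intros w Hw.
    change (Cmod (w - z) < Rmin r (eps / (Rabs K + 1))) in Hw.
    change (Cmod (f w - f z - (w - z) * l) <= eps * Cmod (w - z)).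
    eapply Rle_trans. { apply H. eapply Rlt_le_trans; [exact Hw | apply Rmin_l]. }
    pose proof (Cmod_ge_0 (w - z)).
    assert (Hw' : Cmod (w - z) < eps / (Rabs K + 1))
      by (eapply Rlt_le_trans; [exact Hw | apply Rmin_r]).
    assert (Cmod (w - z) * (Rabs K + 1) <= eps).
    { apply Rlt_le. apply (Rmult_lt_compat_r _ _ _ HK) in Hw'.
      unfold Rdiv in Hw'. rewrite Rmult_assoc, Rinv_l, Rmult_1_r in Hw'; lra. }
    pose proof (Rle_abs K). nra.
Qed.

Lemma cderive_C_derive f z l :
  cderive f z l -> C_derive f z = l.
Proof. apply is_C_derive_unique. Qed.

(** The neighbourhoods of the definitions are squares; discs define the same
    filter. *)
Lemma locally_Cmod (z : C) (P : C -> Prop) :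
  locally z P <-> exists r, 0 < r /\ forall w, Cmod (w - z) < r -> P w.
Proof.
  split.
  - intros [eps H]. exists eps. split. { apply eps. }
    intros w Hw. apply H. now apply C_NormedModule_mixin_compat1.
  - intros [r [Hr H]].
    assert (Hr' : 0 < r / sqrt 2) by (apply Rdiv_lt_0_compat; trivial; apply Rlt_sqrt2_0).
    exists (mkposreal _ Hr'). intros w Hw. apply H.
    apply C_NormedModule_mixin_compat2 in Hw. simpl in Hw.
    change (Cmod (w - z) < sqrt 2 * (r / sqrt 2)) in Hw.
    replace (sqrt 2 * (r / sqrt 2)) with r in Hw; trivial.
    field. apply sqrt2_neq_0.
Qed.

Lemma cderive_inv z : z <> RtoC 0 -> cderive Cinv z (- / (z * z))%C.
Proof.
  intros Hz. pose proof (proj1 (Cmod_gt_0 z) Hz) as Hz0.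
  apply cderive_quadratic with (r := Cmod z / 2) (K := 2 / Cmod z ^ 3). { lra. }
  intros w Hw.
  assert (Hw2 : Cmod z / 2 < Cmod w).
  { assert (Cmod z <= Cmod w + Cmod (w - z)).
    { replace z with (w + - (w - z))%C at 1 by ring.
      rewrite <- (Cmod_opp (w - z)). apply Cmod_triangle. } lra. }
  assert (Hw0 : w <> RtoC 0) by (apply Cmod_gt_0; lra).
  replace (/ w - / z - (w - z) * - / (z * z))%C with ((w - z) * (w - z) * / (z * z * w))%C
    by (field; auto).
  assert (z * z * w <> 0)%C by (repeat apply Cmult_neq_0; auto).
  rewrite !Cmod_mult, Cmod_inv, !Cmod_mult by assumption.
  replace (2 / Cmod z ^ 3) with (/ (Cmod z * Cmod z * (Cmod z / 2))) by (field; lra).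
  rewrite Rmult_comm. simpl (_ ^ 2). rewrite Rmult_1_r.
  apply Rmult_le_compat_r. { pose proof (Cmod_ge_0 (w - z)); nra. }
  apply Rinv_le_contravar. { apply Rmult_lt_0_compat; nra. }
  apply Rmult_le_compat_l; nra.
Qed.

Lemma cderive_continuous f z l eps :
  cderive f z l -> 0 < eps ->
  exists r, 0 < r /\ forall w, Cmod (w - z) < r -> Cmod (f w - f z) < eps.
Proof.
  intros Hf He.
  assert (Hc : @continuous (AbsRing_UniformSpace C_AbsRing) C_NormedModule f z).
  { apply (ex_derive_continuous (K := C_AbsRing) (V := C_NormedModule)). now exists l. }
  destruct (Hc (fun y => Cmod (y - f z) < eps)) as [d Hd].
  - apply locally_Cmod. now exists eps.
  - exists d. split. { apply d. } exact Hd.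
Qed.

(** * Complex power series *)

Definition cseries (a : nat -> C) (l : C) : Prop :=
  @is_series C_AbsRing C_NormedModule a l.

Lemma cseries_ext a b l : (forall k, a k = b k) -> cseries a l -> cseries b l.
Proof. exact (is_series_ext (K := C_AbsRing) (V := C_NormedModule) a b l). Qed.

Lemma cseries_unique a l l' : cseries a l -> cseries a l' -> l = l'.
Proof.
  exact (filterlim_locally_unique (K := C_AbsRing) (V := C_NormedModule) (F := eventually)
           (sum_n (G := C_NormedModule) a) l l').
Qed.

Lemma cseries_plus a b la lb :
  cseries a la -> cseries b lb -> cseries (fun k => a k + b k)%C (la + lb)%C.
Proof. exact (is_series_plus (K := C_AbsRing) (V := C_NormedModule) a b la lb). Qed.

Lemma cseries_scal c a l : cseries a l -> cseries (fun k => c * a k)%C (c * l)%C.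
Proof. exact (is_series_scal (K := C_AbsRing) (V := C_NormedModule) c a l). Qed.

Lemma cseries_tail a l : cseries a l <-> cseries (fun k => a (S k)) (l - a 0%nat)%C.
Proof.
  split; intros H.
  - apply (is_series_incr_1 (K := C_AbsRing) (V := C_NormedModule)).
    replace l with (plus (l - a 0%nat)%C (a 0%nat)) in H; trivial.
    change (l - a 0%nat + a 0%nat = l)%C. ring.
  - apply (is_series_decr_1 (K := C_AbsRing) (V := C_NormedModule)). exact H.
Qed.

Lemma cseries_dominated a b lb :
  (forall k, Cmod (a k) <= b k) -> is_series b lb ->
  exists l, cseries a l.
Proof.
  intros H Hb.
  exact (ex_series_le (K := C_AbsRing) (V := C_CompleteNormedModule) a b H (ex_intro _ lb Hb)).
Qed.

Lemma cseries_le a b l lb :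
  (forall k, Cmod (a k) <= b k) -> cseries a l -> is_series b lb -> Cmod l <= lb.
Proof.
  intros H Ha Hb.
  assert (Hs : forall n, Cmod (sum_n (G := C_NormedModule) a n) <= sum_n b n).
  { induction n as [|n IH].
    - rewrite !sum_O. apply H.
    - rewrite !sum_Sn.
      eapply Rle_trans; [apply Cmod_triangle | apply Rplus_le_compat; [exact IH | apply H]]. }
  change (Rbar_le (Cmod l) lb).
  apply (filterlim_le (F := eventually)
    (fun n => Cmod (sum_n (G := C_NormedModule) a n)) (sum_n b)).
  - now exists 0%nat.
  - apply (filterlim_comp _ _ _ (sum_n (G := C_NormedModule) a) Cmod eventually (locally l)).
    + exact Ha.
    + exact (filterlim_norm (K := C_AbsRing) (V := C_NormedModule) l).
  - exact Hb.
Qed.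

(** The radius is kept explicit so that several expansions at one point can be
    compared on a common disc. *)
Definition expansion (f : C -> C) (z0 : C) (a : nat -> C) (r : R) : Prop :=
  0 < r /\ forall z, Cmod (z - z0) < r ->
    cseries (fun k => a k * (z - z0) ^ k)%C (f z).

Lemma pow_n_Cpow (z : C) k : @pow_n C_Ring z k = (z ^ k)%C.
Proof. induction k; simpl; [reflexivity | now rewrite IHk]. Qed.

Lemma analytic_expansion f z0 :
  analytic_at f z0 <-> exists a r, expansion f z0 a r.
Proof.
  assert (E : forall a z l,
    @is_pseries C_AbsRing C_NormedModule a z l <-> cseries (fun k => a k * z ^ k)%C l).
  { intros a z l. split; apply cseries_ext; intros k;
      rewrite <- pow_n_Cpow; [apply Cmult_comm | symmetry; apply Cmult_comm]. }
  split.
  - intros [a H]. apply locally_Cmod in H as [r [Hr H]]. exists a, r.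
    split; trivial. intros z Hz. apply (proj1 (E a (z - z0)%C (f z))). now apply H.
  - intros [a [r [Hr H]]]. exists a. apply locally_Cmod. exists r.
    split; trivial. intros z Hz. apply (proj2 (E a (z - z0)%C (f z))). now apply H.
Qed.

(** The terms at the point [z0 + r/2] are bounded since the partial sums are;
    the bound decides absolute convergence in every smaller disc. *)
Lemma expansion_coef_bound f z0 a r :
  expansion f z0 a r ->
  exists rho K, 0 < rho < r /\ 0 < K /\ forall k, Cmod (a k) * rho ^ k <= K.
Proof.
  intros [Hr H].
  destruct (filterlim_bounded (K := C_AbsRing) (V := C_NormedModule)
    (sum_n (G := C_NormedModule) (fun k => a k * (RtoC (r / 2)) ^ k)%C)) as [K0 HK].
  { exists (f (z0 + RtoC (r / 2))%C).
    assert (Hz : (z0 + RtoC (r / 2) - z0)%C = RtoC (r / 2)) by ring.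
    specialize (H (z0 + RtoC (r / 2))%C). rewrite Hz in H. apply H.
    rewrite Cmod_R, Rabs_pos_eq; lra. }
  change (forall n,
    Cmod (sum_n (G := C_NormedModule) (fun k => a k * RtoC (r / 2) ^ k)%C n) <= K0) in HK.
  assert (HK0 : 0 <= K0) by (eapply Rle_trans; [apply Cmod_ge_0 | apply (HK 0%nat)]).
  (* A term is a difference of two partial sums, hence the factor two. *)
  exists (r / 2), (2 * K0 + 1). repeat split; try lra.
  assert (Ht : forall k, Cmod (a k * RtoC (r / 2) ^ k) <= 2 * K0).
  { intros [|k].
    - specialize (HK 0%nat). rewrite sum_O in HK. lra.
    - pose proof (HK k) as H1. pose proof (HK (S k)) as H2. rewrite sum_Sn in H2.
      set (s := sum_n _ k) in *. set (t := (a (S k) * _)%C) in *.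
      change (Cmod (s + t) <= K0) in H2.
      replace t with ((s + t) + - s)%C by ring.
      eapply Rle_trans; [apply Cmod_triangle|]. rewrite Cmod_opp. lra. }
  intros k. specialize (Ht k).
  rewrite Cmod_mult, Cmod_pow, Cmod_R, Rabs_pos_eq in Ht; lra.
Qed.

Lemma geom_series_half K : is_series (fun k => K * (1 / 2) ^ k) (K * 2).
Proof.
  replace (K * 2) with (K * / (1 - 1 / 2)) by field.
  apply (is_series_scal_l (K := R_AbsRing) (V := R_NormedModule)).
  apply is_series_geom. rewrite Rabs_pos_eq; lra.
Qed.

Lemma cseries_zero : cseries (fun _ => RtoC 0) (RtoC 0).
Proof.
  destruct (cseries_dominated (fun _ => RtoC 0) _ _
    (fun k => Req_le _ _ (eq_trans Cmod_0 (eq_sym (Rmult_0_l ((1/2)^k)))))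
    (geom_series_half 0)) as [l Hl].
  apply (cseries_scal (RtoC 0)) in Hl. rewrite (Cmult_0_l l) in Hl.
  revert Hl. apply cseries_ext. intros; apply Cmult_0_l.
Qed.

Lemma expansion_value f z0 a r : expansion f z0 a r -> f z0 = a 0%nat.
Proof.
  intros [Hr H].
  assert (H0 := H z0). replace (z0 - z0)%C with (RtoC 0) in H0 by ring.
  rewrite Cmod_0 in H0. specialize (H0 Hr).
  apply cseries_unique with (1 := H0). apply cseries_tail.
  apply cseries_ext with (a := fun _ => RtoC 0).
  - intros k. simpl. ring.
  - simpl. replace (a 0%nat - a 0%nat * RtoC 1)%C with (RtoC 0) by ring. exact cseries_zero.
Qed.

(** Removing the constant term shifts the coefficients.  Iterating this yields
    Taylor formulas whose remainder is again a power series, hence bounded. *)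
Lemma expansion_divide f z0 a r :
  expansion f z0 a r ->
  exists g, expansion g z0 (fun k => a (S k)) r /\
    forall z, f z = (a 0%nat + (z - z0) * g z)%C.
Proof.
  intros Hf. pose proof (expansion_value _ _ _ _ Hf) as H0. destruct Hf as [Hr H].
  assert (Hc : exists g0, cseries (fun k => a (S k) * (z0 - z0) ^ k)%C g0).
  { destruct (cseries_dominated (fun k => a (S k) * (z0 - z0) ^ k)%C
       (fun k => Cmod (a 1%nat) * (1 / 2) ^ k) (Cmod (a 1%nat) * 2)) as [l Hl].
    - intros [|k].
      + simpl. rewrite Cmult_1_r. lra.
      + replace (a (S (S k)) * (z0 - z0) ^ S k)%C with (RtoC 0) by (simpl; ring).
        rewrite Cmod_0. apply Rmult_le_pos; [apply Cmod_ge_0 | apply pow_le; lra].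
    - apply geom_series_half.
    - now exists l. }
  destruct Hc as [g0 Hg0].
  (* The quotient extended to the centre by the sum [g0] of the shifted series. *)
  exists (fun z => if Ceq_dec z z0 then g0 else ((f z - a 0%nat) / (z - z0))%C).
  split.
  - split; trivial. intros z Hz. destruct (Ceq_dec z z0) as [->|Hne]; trivial.
    assert (Hnz : (z - z0)%C <> RtoC 0) by now apply Cminus_eq_contra.
    specialize (H z Hz). apply (proj1 (cseries_tail _ _)) in H. simpl in H.
    apply (cseries_scal (/ (z - z0))) in H.
    replace ((f z - a 0%nat) / (z - z0))%C with (/ (z - z0) * (f z - a 0%nat * RtoC 1))%C
      by (field; auto).
    revert H. apply cseries_ext. intros k. field; auto.
  - intros z. destruct (Ceq_dec z z0) as [->|Hne].
    + rewrite H0. ring.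
    + field. now apply Cminus_eq_contra.
Qed.

Lemma expansion_bounded f z0 a r :
  expansion f z0 a r ->
  exists r' K, 0 < r' /\ forall z, Cmod (z - z0) < r' -> Cmod (f z) <= K.
Proof.
  intros Hf. destruct (expansion_coef_bound _ _ _ _ Hf) as [rho [K [Hrho [HK Ha]]]].
  exists (rho / 2), (K * 2). split; [lra|]. intros z Hz.
  apply cseries_le with (3 := geom_series_half K) (2 := proj2 Hf z ltac:(lra)).
  intros k. rewrite Cmod_mult, Cmod_pow.
  eapply Rle_trans; [|apply Rmult_le_compat_r with (2 := Ha k); apply pow_le; lra].
  rewrite Rmult_assoc, <- Rpow_mult_distr.
  apply Rmult_le_compat_l; [apply Cmod_ge_0|].
  apply pow_incr. split; [apply Cmod_ge_0 | lra].
Qed.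

(** Coefficients of the termwise derivative. *)
Definition dcoef (a : nat -> C) (k : nat) : C := (RtoC (INR (S k)) * a (S k))%C.

Lemma INR_le_pow2 k : INR (S k) <= 2 ^ k.
Proof.
  induction k as [|k IH]; [simpl; lra|].
  rewrite S_INR. simpl (2 ^ S k).
  assert (1 <= 2 ^ k) by (apply pow_R1_Rle; lra). lra.
Qed.

(** Crude second-order Taylor bound for a power.  The recursion
    [e_(k+1) = (w + d) e_k + d^2 (k+1) w^k] for the remainders keeps the factor
    [|d|^2], at the price of the geometric factor [4^k], which is harmless because
    the series is differentiated on a disc whose radius is one eighth of the
    radius [rho] in [expansion_coef_bound]. *)
Lemma pow_remainder (w d : C) (rad : R) k :
  Cmod w <= rad -> Cmod (w + d) <= rad ->
  Cmod ((w + d) ^ S k - w ^ S k - d * (RtoC (INR (S k)) * w ^ k)) * rad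
    <= Cmod d ^ 2 * (4 * rad) ^ k.
Proof.
  intros Hw Hwd. pose proof (Cmod_ge_0 w) as Hw0. assert (Hr : 0 <= rad) by lra.
  pose proof (Cmod_ge_0 d) as Hd0.
  induction k as [|k IH].
  - simpl. replace (_ - _ - _)%C with (RtoC 0) by ring. rewrite Cmod_0. nra.
  - replace ((w + d) ^ S (S k) - w ^ S (S k) - d * (RtoC (INR (S (S k))) * w ^ S k))%C
      with ((w + d) * ((w + d) ^ S k - w ^ S k - d * (RtoC (INR (S k)) * w ^ k))
            + d * d * (RtoC (INR (S k)) * w ^ k))%C
      by (rewrite (S_INR (S k)), RtoC_plus; simpl; ring).
    set (e := ((w + d) ^ S k - _ - _)%C) in *.
    assert (H1 : Cmod ((w + d) * e + d * d * (RtoC (INR (S k)) * w ^ k)) <=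
       rad * Cmod e + Cmod d ^ 2 * (2 ^ k * rad ^ k)).
    { eapply Rle_trans; [apply Cmod_triangle|].
      rewrite !Cmod_mult, Cmod_pow, Cmod_R, Rabs_pos_eq by apply pos_INR.
      apply Rplus_le_compat.
      - apply Rmult_le_compat_r; trivial. apply Cmod_ge_0.
      - replace (Cmod d * Cmod d) with (Cmod d ^ 2) by ring.
        apply Rmult_le_compat_l; [apply pow_le; trivial|].
        apply Rmult_le_compat; [apply pos_INR | now apply pow_le | apply INR_le_pow2 |].
        apply pow_incr; lra. }
    apply Rmult_le_compat_r with (r := rad) in H1; trivial.
    eapply Rle_trans; [exact H1|].
    rewrite Rmult_plus_distr_r.
    assert (H2 : 2 ^ k * rad ^ k <= (4 * rad) ^ k).
    { rewrite <- Rpow_mult_distr. apply pow_incr; lra. }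
    assert (H3 : 0 <= (4 * rad) ^ k) by (apply pow_le; lra).
    assert (H4 : 0 <= Cmod d ^ 2) by (apply pow_le; lra).
    assert (H5 : Cmod d ^ 2 * (2 ^ k * rad ^ k) * rad <= Cmod d ^ 2 * (4 * rad) ^ k * rad).
    { apply Rmult_le_compat_r; trivial. apply Rmult_le_compat_l; trivial. }
    replace (rad * Cmod e * rad) with (rad * (Cmod e * rad)) by ring.
    assert (H6 := Rmult_le_compat_l rad _ _ Hr IH).
    simpl ((4 * rad) ^ S k).
    assert (0 <= Cmod d ^ 2 * (4 * rad) ^ k * rad)
      by (apply Rmult_le_pos; trivial; apply Rmult_le_pos; trivial).
    lra.
Qed.

(** Termwise differentiation: the remainders of [pow_remainder], summed with the
    coefficients, form a geometric series times [|w - z|^2]. *)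
Lemma expansion_derive f z0 a r :
  expansion f z0 a r ->
  exists r', expansion (C_derive f) z0 (dcoef a) r' /\
    forall z, Cmod (z - z0) < r' -> cderive f z (C_derive f z).
Proof.
  intros Hf. destruct (expansion_coef_bound _ _ _ _ Hf) as [rho [K [Hrho [HK Ha]]]].
  destruct Hf as [Hr H].
  (* Leaves [4 rad = rho / 2] for the factor [4 rad] of [pow_remainder]. *)
  set (rad := rho / 8).
  assert (Hrad : 0 < rad) by (unfold rad; lra).
  assert (Ha' : forall k, Cmod (a (S k)) * (4 * rad) ^ k <= K / rho * (1 / 2) ^ k).
  { intros k. specialize (Ha (S k)). simpl in Ha.
    replace ((4 * rad) ^ k) with ((1 / 2) ^ k * rho ^ k)
      by (rewrite <- Rpow_mult_distr; f_equal; unfold rad; lra).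
    assert (Hp : 0 <= (1 / 2) ^ k) by (apply pow_le; lra).
    assert (Cmod (a (S k)) * rho ^ k <= K / rho).
    { apply Rmult_le_reg_r with rho; [lra|].
      replace (K / rho * rho) with K by (field; lra). lra. }
    nra. }
  assert (Hd : forall z, Cmod (z - z0) < rad -> exists l,
    cseries (fun k => dcoef a k * (z - z0) ^ k)%C l /\ cderive f z l).
  { intros z Hz.
    destruct (cseries_dominated (fun k => dcoef a k * (z - z0) ^ k)%C
       (fun k => K / rho * (1 / 2) ^ k) (K / rho * 2)) as [l Hl].
    { intros k. eapply Rle_trans; [|apply Ha'].
      unfold dcoef. rewrite !Cmod_mult, Cmod_pow, Cmod_R, Rabs_pos_eq by apply pos_INR.
      rewrite (Rmult_comm (INR (S k))), Rmult_assoc.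
      apply Rmult_le_compat_l; [apply Cmod_ge_0|].
      apply Rle_trans with (2 ^ k * rad ^ k).
      - apply Rmult_le_compat; [apply pos_INR | apply pow_le, Cmod_ge_0 | apply INR_le_pow2 |].
        apply pow_incr. split; [apply Cmod_ge_0 | lra].
      - rewrite <- Rpow_mult_distr. apply pow_incr. lra. }
    { apply geom_series_half. }
    exists l. split; trivial.
    apply cderive_quadratic with (r := rad - Cmod (z - z0)) (K := K / rho * 2 / rad); [lra|].
    intros w Hw.
    assert (Hwz : Cmod (w - z0) < rad).
    { replace (w - z0)%C with ((w - z) + (z - z0))%C by ring.
      eapply Rle_lt_trans; [apply Cmod_triangle | lra]. }
    assert (Hs : cseries (fun k => a (S k) *
        ((w - z0) ^ S k - (z - z0) ^ S k - (w - z) * (RtoC (INR (S k)) * (z - z0) ^ k)))%C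
        (f w - f z - (w - z) * l)%C).
    { pose proof (proj1 (cseries_tail _ _) (H w ltac:(unfold rad in *; lra))) as H1.
      pose proof (proj1 (cseries_tail _ _) (H z ltac:(unfold rad in *; lra))) as H2.
      pose proof (cseries_plus _ _ _ _ H1 (cseries_plus _ _ _ _ (cseries_scal (RtoC (-1)) _ _ H2)
         (cseries_scal (- (w - z))%C _ _ Hl))) as H3.
      replace (f w - f z - (w - z) * l)%C with
        (f w - a 0%nat * (w - z0) ^ 0 +
         (RtoC (-1) * (f z - a 0%nat * (z - z0) ^ 0) + - (w - z) * l))%C
        by (simpl; ring).
      revert H3. apply cseries_ext. intros k. unfold dcoef. ring. }
    assert (Hrem := fun Hk => cseries_le _
       (fun k => Cmod (w - z) ^ 2 / rad * (K / rho) * (1 / 2) ^ k) _ _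
       Hk Hs (geom_series_half _)).
    replace (K / rho * 2 / rad * Cmod (w - z) ^ 2) with
      (Cmod (w - z) ^ 2 / rad * (K / rho) * 2) by (field; lra).
    apply Hrem. intros k.
    rewrite Cmod_mult.
    pose proof (pow_remainder (z - z0) (w - z) rad k ltac:(lra)) as Hp.
    replace ((z - z0) + (w - z))%C with (w - z0)%C in Hp by ring.
    specialize (Hp ltac:(lra)).
    set (e := Cmod (_ - _ - _)) in *.
    apply Rmult_le_reg_r with rad; trivial.
    rewrite Rmult_assoc.
    apply Rle_trans with (Cmod (a (S k)) * (Cmod (w - z) ^ 2 * (4 * rad) ^ k)).
    { apply Rmult_le_compat_l; trivial. apply Cmod_ge_0. }
    replace (Cmod (w - z) ^ 2 / rad * (K / rho) * (1 / 2) ^ k * rad) with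
      (Cmod (w - z) ^ 2 * (K / rho * (1 / 2) ^ k)) by (field; lra).
    replace (Cmod (a (S k)) * (Cmod (w - z) ^ 2 * (4 * rad) ^ k)) with
      (Cmod (w - z) ^ 2 * (Cmod (a (S k)) * (4 * rad) ^ k)) by ring.
    apply Rmult_le_compat_l; [apply pow_le, Cmod_ge_0 | apply Ha']. }
  exists rad. split; [split; trivial|]; intros z Hz; destruct (Hd z Hz) as [l [Hl Hfl]];
    rewrite (cderive_C_derive _ _ _ Hfl); trivial.
Qed.

(** * Products of power series and the identity theorem *)

(** Write [f = a 0 + h g] with [g] bounded; on the segment this says
    [|a 0| <= K |h|] for arbitrarily small [h]. *)
Lemma expansion_zero_direction_0 f z0 a r d r' :
  expansion f z0 a r -> d <> RtoC 0 -> 0 < r' ->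
  (forall t, 0 < t < r' -> f (z0 + RtoC t * d)%C = RtoC 0) ->
  a 0%nat = RtoC 0.
Proof.
  intros Hf Hd Hr' H.
  destruct (expansion_divide _ _ _ _ Hf) as [g [Hg Hfg]].
  destruct (expansion_bounded _ _ _ _ Hg) as [r1 [K [Hr1 HK]]].
  pose proof (proj1 (Cmod_gt_0 d) Hd) as Hd0.
  apply Cmod_eq_0. apply Rle_antisym; [|apply Cmod_ge_0].
  apply le_epsilon. intros eps He. rewrite Rplus_0_l.
  assert (HK0 : 0 <= K).
  { eapply Rle_trans; [apply Cmod_ge_0|]. apply (HK z0).
    replace (z0 - z0)%C with (RtoC 0) by ring. now rewrite Cmod_0. }
  set (t := Rmin (r' / 2) (Rmin (r1 / 2 / Cmod d) (eps / (K + 1) / Cmod d))).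
  assert (Ht : 0 < t).
  { unfold t. repeat apply Rmin_pos; repeat apply Rdiv_lt_0_compat; lra. }
  assert (Ht1 : t <= r' / 2) by apply Rmin_l.
  assert (Ht2 : t * Cmod d <= r1 / 2).
  { apply Rle_div_r; [exact Hd0|].
    unfold t. eapply Rle_trans; [apply Rmin_r | apply Rmin_l]. }
  assert (Ht3 : t * Cmod d <= eps / (K + 1)).
  { apply Rle_div_r; [exact Hd0|].
    unfold t. eapply Rle_trans; [apply Rmin_r | apply Rmin_r]. }
  specialize (H t ltac:(lra)). rewrite Hfg in H.
  replace (z0 + RtoC t * d - z0)%C with (RtoC t * d)%C in H by ring.
  assert (Hm : Cmod (RtoC t * d) = t * Cmod d)
    by (rewrite Cmod_mult, Cmod_R, Rabs_pos_eq; lra).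
  specialize (HK (z0 + RtoC t * d)%C).
  replace (z0 + RtoC t * d - z0)%C with (RtoC t * d)%C in HK by ring.
  rewrite Hm in HK. specialize (HK ltac:(lra)).
  set (G := g (z0 + RtoC t * d)%C) in *.
  replace (a 0%nat) with (- (RtoC t * d * G))%C.
  - rewrite Cmod_opp, Cmod_mult, Hm.
    apply Rle_trans with (eps / (K + 1) * K).
    + apply Rmult_le_compat; trivial; [nra | apply Cmod_ge_0].
    + apply Rmult_le_reg_r with (K + 1); [lra|].
      replace (eps / (K + 1) * K * (K + 1)) with (eps * K) by (field; lra). nra.
  - replace (a 0%nat) with ((a 0%nat + RtoC t * d * G) - RtoC t * d * G)%C by ring.
    rewrite H. ring.
Qed.

(** A power series that vanishes on a segment issuing from its centre is zero:
    divide by [h] and repeat. *)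
Lemma expansion_zero_direction f z0 a r d r' :
  expansion f z0 a r -> d <> RtoC 0 -> 0 < r' ->
  (forall t, 0 < t < r' -> f (z0 + RtoC t * d)%C = RtoC 0) ->
  forall k, a k = RtoC 0.
Proof.
  intros Hf Hd Hr' H k. revert f a Hf H. induction k as [|k IH]; intros f a Hf H.
  - exact (expansion_zero_direction_0 _ _ _ _ _ _ Hf Hd Hr' H).
  - pose proof (expansion_zero_direction_0 _ _ _ _ _ _ Hf Hd Hr' H) as Ha.
    destruct (expansion_divide _ _ _ _ Hf) as [g [Hg Hfg]].
    apply (IH g (fun j => a (S j)) Hg).
    intros t Ht. specialize (H t Ht). rewrite Hfg, Ha in H.
    replace (z0 + RtoC t * d - z0)%C with (RtoC t * d)%C in H by ring.
    assert (Ht0 : RtoC t <> RtoC 0) by (intros E; apply RtoC_inj in E; lra).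
    set (G := g (z0 + RtoC t * d)%C) in *.
    replace G with (/ (RtoC t * d) * (RtoC 0 + RtoC t * d * G))%C by (field; auto).
    rewrite H. ring.
Qed.

Lemma expansion_zero f z0 a r :
  expansion f z0 a r -> (forall k, a k = RtoC 0) ->
  forall z, Cmod (z - z0) < r -> f z = RtoC 0.
Proof.
  intros [_ H] Ha z Hz. specialize (H z Hz).
  apply cseries_unique with (1 := H).
  apply (cseries_scal (RtoC 0)) in H. rewrite Cmult_0_l in H.
  revert H. apply cseries_ext. intros k. rewrite Ha. ring.
Qed.

Lemma Re_sum_n u n : Re (sum_n (G := C_NormedModule) u n) = sum_n (fun k => Re (u k)) n.
Proof. induction n as [|n IH]; [now rewrite !sum_O | now rewrite !sum_Sn, <- IH]. Qed.

Lemma Im_sum_n u n : Im (sum_n (G := C_NormedModule) u n) = sum_n (fun k => Im (u k)) n.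
Proof. induction n as [|n IH]; [now rewrite !sum_O | now rewrite !sum_Sn, <- IH]. Qed.

Lemma cseries_re_im (u : nat -> C) (l : C) :
  cseries u l <->
  is_series (fun n => Re (u n)) (Re l) /\ is_series (fun n => Im (u n)) (Im l).
Proof.
  split.
  - intros H. split; intros P [eps HP].
    + destruct (H (fun z => P (Re z))) as [N HN].
      * exists eps. intros y Hy. apply HP, Hy.
      * exists N. intros n Hn. rewrite <- Re_sum_n. now apply HN.
    + destruct (H (fun z => P (Im z))) as [N HN].
      * exists eps. intros y Hy. apply HP, Hy.
      * exists N. intros n Hn. rewrite <- Im_sum_n. now apply HN.
  - intros [HR HI] P [eps HP].
    destruct (HR _ (locally_ball (Re l) eps)) as [N1 H1].
    destruct (HI _ (locally_ball (Im l) eps)) as [N2 H2].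
    exists (max N1 N2). intros n Hn. apply HP. split.
    + change (ball (Re l) eps (Re (sum_n (G := C_NormedModule) u n))).
      rewrite Re_sum_n. apply H1. lia.
    + change (ball (Im l) eps (Im (sum_n (G := C_NormedModule) u n))).
      rewrite Im_sum_n. apply H2. lia.
Qed.

Definition cauchy (a b : nat -> C) (n : nat) : C :=
  sum_n (G := C_NormedModule) (fun k => a k * b (n - k)%nat)%C n.

Lemma sum_n_Rminus (f g : nat -> R) n :
  sum_n (fun k => f k - g k) n = sum_n f n - sum_n g n.
Proof.
  induction n as [|n IH]; [now rewrite !sum_O|].
  rewrite !sum_Sn, IH. unfold plus; simpl. ring.
Qed.

(** Mertens' theorem, applied to the four products of real and imaginary parts. *)
Lemma cseries_mult u v lu lv K L :
  (forall k, Cmod (u k) <= K * (1 / 2) ^ k) ->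
  (forall k, Cmod (v k) <= L * (1 / 2) ^ k) ->
  cseries u lu -> cseries v lv -> cseries (cauchy u v) (lu * lv)%C.
Proof.
  intros Hu Hv Su Sv.
  apply cseries_re_im in Su as [Sur Sui]. apply cseries_re_im in Sv as [Svr Svi].
  assert (D : forall (g : nat -> R) (c : nat -> C) M, (forall k, Rabs (g k) <= Cmod (c k)) ->
    (forall k, Cmod (c k) <= M * (1 / 2) ^ k) -> ex_series (fun k => Rabs (g k))).
  { intros g c M H1 H2.
    apply (ex_series_le (K := R_AbsRing) (V := R_CompleteNormedModule) _
      (fun k => M * (1 / 2) ^ k)).
    - intros k. change (Rabs (Rabs (g k)) <= M * (1 / 2) ^ k). rewrite Rabs_Rabsolu.
      eapply Rle_trans; [apply H1 | apply H2].
    - eexists. apply geom_series_half. }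
  assert (Ir : forall c : C, Rabs (Re c) <= Cmod c) by exact re_le_Cmod.
  assert (Ii : forall c : C, Rabs (Im c) <= Cmod c).
  { intros c. eapply Rle_trans; [|apply Rmax_Cmod]. apply Rmax_r. }
  pose proof (D _ u K (fun k => Ir (u k)) Hu) as Dur.
  pose proof (D _ u K (fun k => Ii (u k)) Hu) as Dui.
  pose proof (D _ v L (fun k => Ir (v k)) Hv) as Dvr.
  pose proof (D _ v L (fun k => Ii (v k)) Hv) as Dvi.
  apply cseries_re_im. split.
  - pose proof (is_series_minus _ _ _ _ (is_series_mult _ _ _ _ Sur Svr Dur Dvr)
      (is_series_mult _ _ _ _ Sui Svi Dui Dvi)) as H.
    revert H. apply is_series_ext. intros n.
    unfold cauchy. rewrite Re_sum_n, <- !sum_n_Reals.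
    symmetry. exact (sum_n_Rminus _ _ n).
  - pose proof (is_series_plus _ _ _ _ (is_series_mult _ _ _ _ Sur Svi Dur Dvi)
      (is_series_mult _ _ _ _ Sui Svr Dui Dvr)) as H.
    revert H. apply is_series_ext. intros n.
    unfold cauchy. rewrite Im_sum_n, <- !sum_n_Reals.
    symmetry. exact (sum_n_plus (G := R_AbelianMonoid) _ _ n).
Qed.

Lemma expansion_mult f g z0 a b r r' :
  expansion f z0 a r -> expansion g z0 b r' ->
  exists r'', expansion (fun z => f z * g z)%C z0 (cauchy a b) r''.
Proof.
  intros Hf Hg.
  destruct (expansion_coef_bound _ _ _ _ Hf) as [p [K [Hp [HK Ha]]]].
  destruct (expansion_coef_bound _ _ _ _ Hg) as [q [L [Hq [HL Hb]]]].
  set (s := Rmin (p / 2) (q / 2)).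
  assert (Hs : 0 < s) by (apply Rmin_pos; lra).
  assert (s <= p / 2) by apply Rmin_l. assert (s <= q / 2) by apply Rmin_r.
  assert (D : forall (c : nat -> C) rho M h, (forall k, Cmod (c k) * rho ^ k <= M) ->
    0 < rho -> Cmod h <= rho / 2 -> forall k, Cmod (c k * h ^ k) <= M * (1 / 2) ^ k).
  { intros c rho M h Hc Hrho Hh k. rewrite Cmod_mult, Cmod_pow.
    eapply Rle_trans; [|apply Rmult_le_compat_r with (2 := Hc k); apply pow_le; lra].
    rewrite Rmult_assoc, <- Rpow_mult_distr.
    apply Rmult_le_compat_l; [apply Cmod_ge_0|].
    apply pow_incr. split; [apply Cmod_ge_0 | lra]. }
  exists s. split; trivial. intros z Hz.
  pose proof (cseries_mult _ _ _ _ K L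
    (D a p K (z - z0)%C Ha ltac:(lra) ltac:(lra)) (D b q L (z - z0)%C Hb ltac:(lra) ltac:(lra))
    (proj2 Hf z ltac:(lra)) (proj2 Hg z ltac:(lra))) as H1.
  revert H1. apply cseries_ext. intros n. unfold cauchy.
  transitivity (sum_n (G := C_NormedModule)
    (fun k => mult (K := C_Ring) (a k * b (n - k)%nat)%C ((z - z0) ^ n)%C) n).
  - apply (sum_n_ext_loc (G := C_NormedModule)). intros k Hk.
    change (a k * (z - z0) ^ k * (b (n - k)%nat * (z - z0) ^ (n - k)) =
      a k * b (n - k)%nat * (z - z0) ^ n)%C.
    replace n with (k + (n - k))%nat at 4 by lia. rewrite Cpow_add_r. ring.
  - exact (sum_n_mult_r (K := C_Ring) ((z - z0) ^ n)%C (fun k => a k * b (n - k)%nat)%C n).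
Qed.

Lemma expansion_plus f g z0 a b r r' :
  expansion f z0 a r -> expansion g z0 b r' ->
  expansion (fun z => f z + g z)%C z0 (fun k => a k + b k)%C (Rmin r r').
Proof.
  intros [Hr Hf] [Hr' Hg]. split. { now apply Rmin_pos. }
  intros z Hz. pose proof (Rmin_l r r'). pose proof (Rmin_r r r').
  pose proof (cseries_plus _ _ _ _ (Hf z ltac:(lra)) (Hg z ltac:(lra))) as H1.
  revert H1. apply cseries_ext. intros k. ring.
Qed.

Lemma expansion_affine c d z0 :
  expansion (fun z => c + d * (z - z0))%C z0
    (fun k => match k with 0%nat => c | 1%nat => d | _ => RtoC 0 end) 1.
Proof.
  split; [lra|]. intros z _.
  apply cseries_tail, cseries_tail. simpl.
  replace (c + d * (z - z0) - c * 1 - d * ((z - z0) * 1))%C with (RtoC 0) by ring.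
  generalize cseries_zero. apply cseries_ext. intros; ring.
Qed.

Lemma analytic_plus f g z0 :
  analytic_at f z0 -> analytic_at g z0 -> analytic_at (fun z => f z + g z)%C z0.
Proof.
  rewrite !analytic_expansion. intros [a [r Hf]] [b [r' Hg]].
  eexists _, _. exact (expansion_plus _ _ _ _ _ _ _ Hf Hg).
Qed.

Lemma analytic_mult f g z0 :
  analytic_at f z0 -> analytic_at g z0 -> analytic_at (fun z => f z * g z)%C z0.
Proof.
  rewrite !analytic_expansion. intros [a [r Hf]] [b [r' Hg]].
  destruct (expansion_mult _ _ _ _ _ _ _ Hf Hg) as [r'' H]. eauto.
Qed.

Lemma analytic_affine c d z0 : analytic_at (fun z => c + d * (z - z0))%C z0.
Proof. apply analytic_expansion. eexists _, _. apply expansion_affine. Qed.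

Lemma analytic_ext f g z0 :
  (forall z, f z = g z) -> analytic_at f z0 -> analytic_at g z0.
Proof.
  intros E [a H]. exists a. revert H. apply filter_imp. intros z. now rewrite E.
Qed.

Lemma analytic_const c z0 : analytic_at (fun _ => c) z0.
Proof.
  apply (analytic_ext (fun z => c + RtoC 0 * (z - z0))%C); [intros; ring|].
  apply analytic_affine.
Qed.

Lemma analytic_power z0 n : analytic_at (fun z => (z - z0) ^ n)%C z0.
Proof.
  induction n as [|n IH].
  - apply (analytic_const (RtoC 1)).
  - apply (analytic_mult (fun z => z - z0)%C (fun z => (z - z0) ^ n)%C); trivial.
    apply (analytic_ext (fun z => RtoC 0 + RtoC 1 * (z - z0))%C); [intros; ring|].
    apply analytic_affine.
Qed.

(** The segment may lie on one side only: the real direction is used for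
    identities on the real line, the direction [i] for identities known in the
    upper half-plane. *)
Lemma analytic_identity f z0 d r' :
  analytic_at f z0 -> d <> RtoC 0 -> 0 < r' ->
  (forall t, 0 < t < r' -> f (z0 + RtoC t * d)%C = RtoC 0) ->
  exists r, 0 < r /\ forall z, Cmod (z - z0) < r -> f z = RtoC 0.
Proof.
  intros Hf Hd Hr' H. apply analytic_expansion in Hf as [a [r Hf]].
  exists r. split; [apply Hf|].
  apply (expansion_zero _ _ _ _ Hf). exact (expansion_zero_direction _ _ _ _ _ _ Hf Hd Hr' H).
Qed.

Lemma analytic_derive f z0 :
  analytic_at f z0 ->
  analytic_at (C_derive f) z0 /\
  exists r, 0 < r /\ forall z, Cmod (z - z0) < r -> cderive f z (C_derive f z).
Proof.
  rewrite !analytic_expansion. intros [a [r Hf]].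
  destruct (expansion_derive _ _ _ _ Hf) as [r' [H1 H2]].
  split; [now exists (dcoef a), r' |]. exists r'. split; trivial. apply H1.
Qed.

Lemma analytic_continuous f z0 eps :
  analytic_at f z0 -> 0 < eps ->
  exists r, 0 < r /\ forall z, Cmod (z - z0) < r -> Cmod (f z - f z0) < eps.
Proof.
  intros Hf He. destruct (analytic_derive _ _ Hf) as [_ [r [Hr H]]].
  apply (cderive_continuous f z0 (C_derive f z0)); trivial.
  apply H. replace (z0 - z0)%C with (RtoC 0) by ring. now rewrite Cmod_0.
Qed.

(** Schwarz reflection on the level of coefficients. *)
Lemma expansion_conj f u a r :
  expansion f (RtoC u) a r ->
  expansion (fun z => Cconj (f (Cconj z))) (RtoC u) (fun k => Cconj (a k)) r.
Proof.
  intros [Hr H]. split; trivial. intros z Hz.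
  assert (E : (Cconj z - RtoC u)%C = Cconj (z - RtoC u)).
  { destruct z as [x y]. unfold Cconj, Cminus, Copp, Cplus, RtoC. simpl. f_equal. ring. }
  specialize (H (Cconj z)). rewrite E, Cmod_conj in H. specialize (H Hz).
  assert (Ek : forall k, Cconj (a k * Cconj (z - RtoC u) ^ k) = (Cconj (a k) * (z - RtoC u) ^ k)%C).
  { intros k. now rewrite Cmult_conj, Cpow_conj, Cconj_conj. }
  apply cseries_re_im in H as [H1 H2]. apply cseries_re_im. split.
  - revert H1. apply is_series_ext. intros k. now rewrite <- Ek.
  - apply is_series_opp in H2. revert H2. apply is_series_ext. intros k. now rewrite <- Ek.
Qed.

(** * Moebius invariance of the Schwarzian derivative *)

Lemma cderive_eq f z l l' : cderive f z l -> l = l' -> cderive f z l'.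
Proof. now intros H <-. Qed.

Lemma cderive_div f g z a b :
  cderive f z a -> cderive g z b -> g z <> RtoC 0 ->
  cderive (fun w => f w / g w)%C z ((a * g z - f z * b) / (g z * g z))%C.
Proof.
  intros Hf Hg H0. eapply cderive_eq.
  - apply (cderive_mult f (fun w => / g w)%C); [exact Hf|].
    apply (cderive_comp Cinv g); [apply cderive_inv; exact H0 | exact Hg].
  - simpl. field. exact H0.
Qed.

Lemma Cmod_near_trans (z w x : C) r :
  Cmod (w - z) < r -> Cmod (x - w) < r - Cmod (w - z) -> Cmod (x - z) < r.
Proof.
  intros H1 H2. replace (x - z)%C with ((x - w) + (w - z))%C by ring.
  eapply Rle_lt_trans; [apply Cmod_triangle | lra].
Qed.

Lemma Cmod_near_refl (z : C) r : 0 < r -> Cmod (z - z) < r.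
Proof. intros Hr. replace (z - z)%C with (RtoC 0) by ring. now rewrite Cmod_0. Qed.

Lemma C_derive_ball f g dg z r :
  (forall w, Cmod (w - z) < r -> f w = g w) ->
  (forall w, Cmod (w - z) < r -> cderive g w (dg w)) ->
  forall w, Cmod (w - z) < r -> cderive f w (dg w) /\ C_derive f w = dg w.
Proof.
  intros H Hg w Hw.
  assert (Hf : cderive f w (dg w)).
  { apply (cderive_ext_near g f w (dg w) (r - Cmod (w - z))); [lra| |now apply Hg].
    intros x Hx. symmetry. apply H. eapply Cmod_near_trans; eassumption. }
  split; trivial. now apply cderive_C_derive.
Qed.

(** With [q = ga B + de], one has [M' = D B' / q^2] where [D] is the determinant,
    so [M''/M' = B''/B' - 2 ga B'/q]; the terms in [q] cancel in the Schwarzian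
    derivative.  The numbers [B1], [B2], [B3] are the successive derivatives of [B]. *)
Lemma schwarzian_mobius B M B1 B2 B3 (al be ga de : C) z r :
  0 < r -> (al * de - be * ga)%C <> RtoC 0 ->
  (forall w, Cmod (w - z) < r ->
    cderive B w (B1 w) /\ cderive B1 w (B2 w) /\ cderive B2 w (B3 w) /\
    B1 w <> RtoC 0 /\ (ga * B w + de)%C <> RtoC 0 /\
    M w = ((al * B w + be) / (ga * B w + de))%C) ->
  schwarzian M z = (B3 z / B1 z - RtoC 3 / RtoC 2 * (B2 z / B1 z * (B2 z / B1 z)))%C.
Proof.
  intros Hr HD H.
  set (q := fun w => (ga * B w + de)%C).
  assert (Hq : forall w, Cmod (w - z) < r -> cderive q w (ga * B1 w)%C).
  { intros w Hw. destruct (H w Hw) as [H1 _]. eapply cderive_eq.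
    - apply (cderive_plus (fun w => ga * B w)%C (fun _ => de)); [|apply cderive_const].
      apply (cderive_mult (fun _ => ga) B); [apply cderive_const | exact H1].
    - ring. }
  assert (HM1 : forall w, Cmod (w - z) < r ->
     cderive M w ((al * de - be * ga) * (B1 w / (q w * q w)))%C /\
     C_derive M w = ((al * de - be * ga) * (B1 w / (q w * q w)))%C).
  { apply (C_derive_ball M (fun w => (al * B w + be) / q w)%C).
    - intros w Hw. apply H, Hw.
    - intros w Hw. destruct (H w Hw) as (H1 & _ & _ & _ & Hn & _). fold (q w) in Hn.
      eapply cderive_eq.
      + apply (cderive_div (fun w => al * B w + be)%C q); [|now apply Hq | exact Hn].
        apply (cderive_plus (fun w => al * B w)%C (fun _ => be)); [|apply cderive_const].
        apply (cderive_mult (fun _ => al) B); [apply cderive_const | exact H1].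
      + unfold q in *. simpl. field. exact Hn. }
  assert (HM2 : forall w, Cmod (w - z) < r ->
     cderive (C_derive M) w ((al * de - be * ga) *
        ((B2 w * q w - RtoC 2 * ga * (B1 w * B1 w)) / (q w * q w * q w)))%C /\
     C_derive (C_derive M) w = ((al * de - be * ga) *
        ((B2 w * q w - RtoC 2 * ga * (B1 w * B1 w)) / (q w * q w * q w)))%C).
  { apply (C_derive_ball _ (fun w => (al * de - be * ga) * (B1 w / (q w * q w)))%C
      (fun w => ((al * de - be * ga) *
        ((B2 w * q w - RtoC 2 * ga * (B1 w * B1 w)) / (q w * q w * q w)))%C)).
    - intros w Hw. apply HM1, Hw.
    - intros w Hw. destruct (H w Hw) as (_ & H2 & _ & _ & Hn & _). fold (q w) in Hn.
      pose proof (Hq w Hw) as Hqw.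
      eapply cderive_eq.
      + apply (cderive_mult (fun _ => (al * de - be * ga)%C)); [apply cderive_const|].
        apply (cderive_div B1 (fun w => q w * q w)%C); [exact H2 | |now apply Cmult_neq_0].
        apply (cderive_mult q q); exact Hqw.
      + simpl. field. exact Hn. }
  assert (HN : forall w, Cmod (w - z) < r ->
     cderive (fun w => C_derive (C_derive M) w / C_derive M w)%C w
       ((B3 w * B1 w - B2 w * B2 w) / (B1 w * B1 w) -
         RtoC 2 * ga * ((B2 w * q w - B1 w * (ga * B1 w)) / (q w * q w)))%C /\
     C_derive (fun w => C_derive (C_derive M) w / C_derive M w)%C w =
       ((B3 w * B1 w - B2 w * B2 w) / (B1 w * B1 w) -
         RtoC 2 * ga * ((B2 w * q w - B1 w * (ga * B1 w)) / (q w * q w)))%C).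
  { apply (C_derive_ball _ (fun w => B2 w / B1 w + (- RtoC 2 * ga) * (B1 w / q w))%C
      (fun w => ((B3 w * B1 w - B2 w * B2 w) / (B1 w * B1 w) -
         RtoC 2 * ga * ((B2 w * q w - B1 w * (ga * B1 w)) / (q w * q w)))%C)).
    - intros w Hw. rewrite (proj2 (HM1 w Hw)), (proj2 (HM2 w Hw)).
      destruct (H w Hw) as (_ & _ & _ & Hn1 & Hn & _). fold (q w) in Hn.
      field. auto.
    - intros w Hw. destruct (H w Hw) as (_ & H2 & H3 & Hn1 & Hn & _). fold (q w) in Hn.
      pose proof (Hq w Hw) as Hqw. eapply cderive_eq.
      + apply (cderive_plus (fun w => B2 w / B1 w)%C (fun w => (- RtoC 2 * ga) * (B1 w / q w))%C).
        * apply cderive_div; eassumption.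
        * apply (cderive_mult (fun _ => (- RtoC 2 * ga)%C)); [apply cderive_const|].
          apply cderive_div; eassumption.
      + simpl. field. auto. }
  pose proof (Cmod_near_refl z r Hr) as Hz.
  unfold schwarzian. rewrite (proj2 (HN z Hz)), (proj2 (HM1 z Hz)), (proj2 (HM2 z Hz)).
  destruct (H z Hz) as (_ & _ & _ & Hn1 & Hn & _). fold (q z) in Hn.
  field. auto.
Qed.

(** The case of the identity transformation. *)
Lemma schwarzian_value B u r :
  0 < r ->
  (forall z, Cmod (z - u) < r ->
     cderive B z (C_derive B z) /\
     cderive (C_derive B) z (C_derive (C_derive B) z) /\
     cderive (C_derive (C_derive B)) z (C_derive (C_derive (C_derive B)) z) /\
     C_derive B z <> RtoC 0) ->
  schwarzian B u = (C_derive (C_derive (C_derive B)) u / C_derive B u -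
    RtoC 3 / RtoC 2 * (C_derive (C_derive B) u / C_derive B u *
                       (C_derive (C_derive B) u / C_derive B u)))%C.
Proof.
  intros Hr H.
  assert (C1 : RtoC 1 <> RtoC 0) by (intros E; apply RtoC_inj in E; lra).
  apply (schwarzian_mobius B B
    (C_derive B) (C_derive (C_derive B)) (C_derive (C_derive (C_derive B)))
    (RtoC 1) (RtoC 0) (RtoC 0) (RtoC 1) u r); trivial.
  - replace (RtoC 1 * RtoC 1 - RtoC 0 * RtoC 0)%C with (RtoC 1) by ring. exact C1.
  - intros w Hw. destruct (H w Hw) as (H1 & H2 & H3 & Hn).
    split; [|split; [|split; [|split; [|split]]]]; trivial.
    + replace (RtoC 0 * B w + RtoC 1)%C with (RtoC 1) by ring. exact C1.
    + field.
Qed.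

Lemma analytic_nonzero_near f z0 :
  analytic_at f z0 -> f z0 <> RtoC 0 ->
  exists r, 0 < r /\ forall z, Cmod (z - z0) < r -> f z <> RtoC 0.
Proof.
  intros Hf H0. apply Cmod_gt_0 in H0.
  destruct (analytic_continuous _ _ _ Hf H0) as [r [Hr H]].
  exists r. split; trivial. intros z Hz E. specialize (H z Hz). rewrite E in H.
  replace (RtoC 0 - f z0)%C with (- f z0)%C in H by ring. rewrite Cmod_opp in H. lra.
Qed.

Lemma analytic_regular_near B u :
  analytic_at B u -> C_derive B u <> RtoC 0 ->
  exists r, 0 < r /\ forall z, Cmod (z - u) < r ->
     cderive B z (C_derive B z) /\
     cderive (C_derive B) z (C_derive (C_derive B) z) /\
     cderive (C_derive (C_derive B)) z (C_derive (C_derive (C_derive B)) z) /\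
     C_derive B z <> RtoC 0.
Proof.
  intros H0 Hn.
  destruct (analytic_derive _ _ H0) as [H1 [r0 [Hr0 D0]]].
  destruct (analytic_derive _ _ H1) as [H2 [r1 [Hr1 D1]]].
  destruct (analytic_derive _ _ H2) as [H3 [r2 [Hr2 D2]]].
  destruct (analytic_nonzero_near _ _ H1 Hn) as [r3 [Hr3 D3]].
  exists (Rmin (Rmin r0 r1) (Rmin r2 r3)). split; [repeat apply Rmin_pos; trivial|].
  intros z Hz.
  pose proof (Rmin_l (Rmin r0 r1) (Rmin r2 r3)). pose proof (Rmin_r (Rmin r0 r1) (Rmin r2 r3)).
  pose proof (Rmin_l r0 r1). pose proof (Rmin_r r0 r1).
  pose proof (Rmin_l r2 r3). pose proof (Rmin_r r2 r3).
  split; [|split; [|split]]; [apply D0 | apply D1 | apply D2 | apply D3]; lra.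
Qed.

(** * The curvature of a contraction at a unimodular boundary point *)

(** Remainders in one-sided Taylor formulas; closed under ring operations, which
    makes the error terms of [curvature_limit_coords] automatic. *)
Definition bounded_right (f : R -> R) : Prop :=
  exists d K, 0 < d /\ forall y, 0 < y < d -> Rabs (f y) <= K.

Lemma bounded_right_const c : bounded_right (fun _ => c).
Proof. exists 1, (Rabs c). split; [lra|]. intros; lra. Qed.

Lemma bounded_right_id : bounded_right (fun y => y).
Proof. exists 1, 1. split; [lra|]. intros y Hy. rewrite Rabs_pos_eq; lra. Qed.

Lemma bounded_right_plus f g :
  bounded_right f -> bounded_right g -> bounded_right (fun y => f y + g y).
Proof.
  intros [d [K [Hd H]]] [d' [K' [Hd' H']]].
  exists (Rmin d d'), (K + K'). split; [now apply Rmin_pos|].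
  intros y Hy. pose proof (Rmin_l d d'). pose proof (Rmin_r d d').
  eapply Rle_trans; [apply Rabs_triang|]. apply Rplus_le_compat; [apply H | apply H']; lra.
Qed.

Lemma bounded_right_mult f g :
  bounded_right f -> bounded_right g -> bounded_right (fun y => f y * g y).
Proof.
  intros [d [K [Hd H]]] [d' [K' [Hd' H']]].
  exists (Rmin d d'), (K * K'). split; [now apply Rmin_pos|].
  intros y Hy. pose proof (Rmin_l d d'). pose proof (Rmin_r d d').
  rewrite Rabs_mult. apply Rmult_le_compat; try apply Rabs_pos; [apply H | apply H']; lra.
Qed.

Lemma bounded_right_opp f : bounded_right f -> bounded_right (fun y => - f y).
Proof.
  intros [d [K [Hd H]]]. exists d, K. split; trivial. intros y Hy. rewrite Rabs_Ropp. auto.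
Qed.

Lemma bounded_right_minus f g :
  bounded_right f -> bounded_right g -> bounded_right (fun y => f y - g y).
Proof.
  intros Hf Hg. apply (bounded_right_plus f (fun y => - g y)); trivial.
  now apply bounded_right_opp.
Qed.

Ltac solve_bounded :=
  repeat first [ assumption | apply bounded_right_id | apply bounded_right_const
    | apply bounded_right_plus | apply bounded_right_minus | apply bounded_right_mult
    | apply bounded_right_opp ].

Lemma at_right_lim_perturb k f :
  bounded_right f -> filterlim (fun y => k + y * f y) (at_right 0) (locally k).
Proof.
  intros [d [K [Hd H]]]. apply filterlim_locally. intros eps.
  assert (HK : 0 < Rabs K + 1) by (pose proof (Rabs_pos K); lra).
  assert (Hd' : 0 < Rmin d (eps / (Rabs K + 1))).
  { apply Rmin_pos; trivial. apply Rdiv_lt_0_compat; trivial. apply eps. }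
  exists (mkposreal _ Hd'). intros y Hy Hy0.
  change (Rabs (y - 0) < Rmin d (eps / (Rabs K + 1))) in Hy.
  rewrite Rminus_0_r, Rabs_pos_eq in Hy by lra.
  pose proof (Rmin_l d (eps / (Rabs K + 1))). pose proof (Rmin_r d (eps / (Rabs K + 1))).
  change (Rabs (k + y * f y - k) < eps).
  replace (k + y * f y - k) with (y * f y) by ring.
  rewrite Rabs_mult, (Rabs_pos_eq y) by lra.
  assert (y * (Rabs K + 1) < eps).
  { apply Rlt_div_r; lra. }
  specialize (H y ltac:(lra)). pose proof (Rle_abs K). nra.
Qed.

(** Here [N] and [Q] are [|w|^2] and [|w'|^2] for
    [w = 1 + i th h + (- th^2/2 + i be) h^2 + (- th be + i ga) h^3 + O(h^4)] at
    [h = i y].  The proof writes [1 - N = y P] and [P^2 - 4 Q = y^2 (k + y E)] with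
    bounded error [E], so that the quotient is [(k + y E) / (4 P^2)] with
    [P -> 2 th]. *)
Lemma curvature_limit_coords (th be ga : R) (s t s' t' : R -> R) (N Q : R -> R) :
  th <> 0 ->
  bounded_right s -> bounded_right t -> bounded_right s' -> bounded_right t' ->
  (exists d, 0 < d /\ forall y, 0 < y < d ->
     N y = (1 - th * y + th ^ 2 / 2 * y ^ 2 + ga * y ^ 3 + y ^ 4 * s y) ^ 2 +
           (- be * y ^ 2 + th * be * y ^ 3 + y ^ 4 * t y) ^ 2 /\
     Q y = (-2 * be * y + 3 * th * be * y ^ 2 + y ^ 3 * s' y) ^ 2 +
           (th - th ^ 2 * y - 3 * ga * y ^ 2 + y ^ 3 * t' y) ^ 2) ->
  filterlim (fun y => 1 / (4 * y ^ 2) - Q y / (1 - N y) ^ 2) (at_right 0)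
    (locally (ga / th + th ^ 2 / 4 - be ^ 2 / th ^ 2)).
Proof.
  intros Hth Hs Ht Hs' Ht' [d [Hd HNQ]].
  (* With [P = 2 th + y p] and [w' = v1 + i v2] one has
     [P = 2 th - 2 th^2 y + (th^3 - 2 ga) y^2 + y^3 p3], [v1 = y (- 2 be + y q1)],
     [P + 2 v2 = 4 th + y X] and [P - 2 v2 = y^2 (th^3 + 4 ga + y (p3 - 2 t'))].
     The formulas for [k] and [E] expand
     [P^2 - 4 Q = (P - 2 v2) (P + 2 v2) - 4 v1^2]. *)
  set (m := fun y => th ^ 2 / 2 + ga * y + y * y * s y).
  set (n := fun y => - be + th * be * y + y * y * t y).
  set (p := fun y => - (th ^ 2 + 2 * m y - 2 * th * y * m y + y * y * (m y * m y + n y * n y))).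
  set (p3 := fun y => -2 * s y + 2 * th * ga + 2 * th * (y * s y) - (m y * m y + n y * n y)).
  set (q1 := fun y => 3 * th * be + y * s' y).
  set (X := fun y => -4 * th ^ 2 + (th ^ 3 - 8 * ga) * y + y * y * (p3 y + 2 * t' y)).
  set (E := fun y => (p3 y - 2 * t' y) * (4 * th + y * X y) + (th ^ 3 + 4 * ga) * X y
                     - 4 * (-4 * be * q1 y + y * (q1 y * q1 y))).
  set (k := 4 * th * (th ^ 3 + 4 * ga) - 16 * be ^ 2).
  assert (Hm : bounded_right m) by (unfold m; solve_bounded).
  assert (Hn : bounded_right n) by (unfold n; solve_bounded).
  assert (Hp : bounded_right p) by (unfold p; solve_bounded).
  assert (Hp3 : bounded_right p3) by (unfold p3; solve_bounded).
  assert (Hq1 : bounded_right q1) by (unfold q1; solve_bounded).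
  assert (HX : bounded_right X) by (unfold X; solve_bounded).
  assert (HE : bounded_right E) by (unfold E; solve_bounded).
  pose proof (at_right_lim_perturb k E HE) as LE.
  pose proof (at_right_lim_perturb (2 * th) p Hp) as Lp.
  assert (Hnz : at_right 0 (fun y => 2 * th + y * p y <> 0)).
  { apply (Lp (fun x => x <> 0)). assert (Hpos : 0 < Rabs (2 * th)) by (apply Rabs_pos_lt; lra).
    exists (mkposreal _ Hpos). intros y Hy E0. subst y.
    change (Rabs (0 - 2 * th) < Rabs (2 * th)) in Hy.
    rewrite Rminus_0_l, Rabs_Ropp in Hy. lra. }
  apply filterlim_ext_loc with
    (f := fun y => (k + y * E y) * / (4 * ((2 * th + y * p y) * (2 * th + y * p y)))).
  { assert (Hd0 : at_right 0 (fun y => 0 < y < d)).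
    { exists (mkposreal d Hd). intros y Hy Hy0.
      change (Rabs (y - 0) < d) in Hy. rewrite Rminus_0_r, Rabs_pos_eq in Hy; lra. }
    generalize (filter_and _ _ Hnz Hd0). apply filter_imp. intros y [H0 Hy].
    destruct (HNQ y Hy) as [HN HQ].
    assert (E1 : 1 - N y = y * (2 * th + y * p y)).
    { rewrite HN. unfold p, m, n. field. }
    assert (E2 : (2 * th + y * p y) ^ 2 - 4 * Q y = y ^ 2 * (k + y * E y)).
    { rewrite HQ. unfold k, E, X, q1, p3, p, m, n. field. }
    rewrite E1. apply Rmult_eq_reg_l with (4 * y ^ 2 * (2 * th + y * p y) ^ 2).
    - transitivity (y ^ 2 * (k + y * E y)); [field; auto|].
      rewrite <- E2. field. split; lra.
    - apply Rmult_integral_contrapositive. split; [nra|]. now apply pow_nonzero. }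
  replace (ga / th + th ^ 2 / 4 - be ^ 2 / th ^ 2) with (k * / (4 * ((2 * th) * (2 * th))))
    by (unfold k; field; trivial).
  apply (filterlim_comp_2 (G := locally k) (H := locally (/ (4 * ((2 * th) * (2 * th)))))
    _ _ Rmult).
  - exact LE.
  - apply (filterlim_comp _ _ _ (fun y => 4 * ((2 * th + y * p y) * (2 * th + y * p y))) Rinv
       (at_right 0) (locally (4 * ((2 * th) * (2 * th))))).
    + apply (filterlim_comp _ _ _ (fun y => 2 * th + y * p y) (fun x => 4 * (x * x))
       (at_right 0) (locally (2 * th))); [exact Lp|].
      apply (continuous_scal_r (K := R_AbsRing) (V := R_NormedModule) 4 (fun x => x * x)).
      apply (continuous_mult (K := R_AbsRing) (fun x => x) (fun x => x)); apply continuous_id.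
    + apply (continuous_Rinv (4 * ((2 * th) * (2 * th)))). nra.
  - apply (filterlim_mult (K := R_AbsRing)).
Qed.

Lemma expansion_scal f z0 a r c b :
  (forall k, b k = c * a k)%C ->
  expansion f z0 a r -> expansion (fun z => c * f z)%C z0 b r.
Proof.
  intros Hb [Hr H]. split; trivial. intros z Hz.
  generalize (cseries_scal c _ _ (H z Hz)). apply cseries_ext.
  intros k. rewrite Hb. ring.
Qed.

Lemma Cconj_R x : Cconj (RtoC x) = RtoC x.
Proof. unfold Cconj, RtoC. simpl. f_equal. ring. Qed.

(** The reflected function [conj(w(conj z))] inverts [w] on the real line; so the
    first coefficients of their product, which is constant, vanish. *)
Lemma unimodular_coefs w u e r r' :
  expansion w (RtoC u) e r -> e 0%nat = RtoC 1 -> 0 < r' ->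
  (forall v, u < v < u + r' -> Cmod (w (RtoC v)) = 1) ->
  Re (e 1%nat) = 0 /\ Re (e 2%nat) = - (Im (e 1%nat)) ^ 2 / 2 /\
  Re (e 3%nat) = - (Im (e 1%nat) * Im (e 2%nat)).
Proof.
  intros Hw H0 Hr' H1.
  destruct (expansion_mult _ _ _ _ _ _ _ Hw (expansion_conj _ _ _ _ Hw)) as [r1 Hm].
  pose proof (expansion_plus _ _ _ _ _ _ _ Hm
    (expansion_affine (- RtoC 1)%C (RtoC 0) (RtoC u))) as HF.
  pose proof (expansion_zero_direction _ _ _ _ (RtoC 1) r' HF) as Hz.
  assert (C1 : RtoC 1 <> RtoC 0) by (intros E; apply RtoC_inj in E; lra).
  specialize (Hz C1 Hr').
  assert (Hc : forall k, (cauchy e (fun k => Cconj (e k)) k +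
     match k with 0%nat => - RtoC 1 | 1%nat => RtoC 0 | S (S _) => RtoC 0 end)%C = RtoC 0).
  { apply Hz. intros t Ht.
    replace (RtoC u + RtoC t * RtoC 1)%C with (RtoC (u + t)) by (rewrite RtoC_plus; ring).
    rewrite Cconj_R, <- Cmod2_conj, H1 by lra.
    rewrite pow1. ring. }
  pose proof (Hc 1%nat) as E1. pose proof (Hc 2%nat) as E2. pose proof (Hc 3%nat) as E3.
  clear Hc Hz HF Hm. unfold cauchy in *.
  rewrite sum_Sn, sum_O in E1. rewrite !sum_Sn, sum_O in E2. rewrite !sum_Sn, sum_O in E3.
  simpl in E1, E2, E3.
  rewrite !H0 in *.
  destruct (e 1%nat) as [p1 q1], (e 2%nat) as [p2 q2], (e 3%nat) as [p3 q3].
  apply (f_equal fst) in E1, E2, E3. simpl in *.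
  assert (p1 = 0) by lra. subst p1. nra.
Qed.

Lemma expansion_taylor3 f z0 a r :
  expansion f z0 a r ->
  exists g r' K, 0 < r' /\ (forall z, Cmod (z - z0) < r' -> Cmod (g z) <= K) /\
    forall z, f z = (a 0%nat + (z - z0) * (a 1%nat + (z - z0) * (a 2%nat + (z - z0) * g z)))%C.
Proof.
  intros Hf.
  destruct (expansion_divide _ _ _ _ Hf) as [g0 [H0 E0]].
  destruct (expansion_divide _ _ _ _ H0) as [g1 [H1 E1]].
  destruct (expansion_divide _ _ _ _ H1) as [g2 [H2 E2]].
  destruct (expansion_bounded _ _ _ _ H2) as [r' [K [Hr' HK]]].
  exists g2, r', K. repeat split; trivial.
  intros z. now rewrite E0, E1, E2.
Qed.

Lemma bounded_right_of_C (g : C -> C) z0 r K (F : R -> R) :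
  0 < r -> (forall z, Cmod (z - z0) < r -> Cmod (g z) <= K) ->
  (forall y, Rabs (F y) <= Cmod (g (z0 + Ci * RtoC y)%C)) -> bounded_right F.
Proof.
  intros Hr H HF. exists r, K. split; trivial. intros y Hy.
  eapply Rle_trans; [apply HF|]. apply H.
  replace (z0 + Ci * RtoC y - z0)%C with (Ci * RtoC y)%C by ring.
  rewrite Cmod_mult, Cmod_Ci, Cmod_R, Rabs_pos_eq; lra.
Qed.

Lemma im_le_Cmod c : Rabs (Im c) <= Cmod c.
Proof. eapply Rle_trans; [|apply Rmax_Cmod]. apply Rmax_r. Qed.

Lemma curvature_limit_unit w v u e r rv r' :
  expansion w (RtoC u) e r -> expansion v (RtoC u) (dcoef e) rv ->
  e 0%nat = RtoC 1 -> 0 < r' ->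
  (forall x, u < x < u + r' -> Cmod (w (RtoC x)) = 1) ->
  Im (e 1%nat) <> 0 ->
  filterlim (fun y => 1 / (4 * y ^ 2) - Cmod (v (RtoC u + Ci * RtoC y)%C) ^ 2 /
       (1 - Cmod (w (RtoC u + Ci * RtoC y)%C) ^ 2) ^ 2) (at_right 0)
    (locally (Im (e 3%nat) / Im (e 1%nat) + Im (e 1%nat) ^ 2 / 4
              - Im (e 2%nat) ^ 2 / Im (e 1%nat) ^ 2)).
Proof.
  intros Hw Hv H0 Hr' H1 Hth.
  destruct (unimodular_coefs _ _ _ _ _ Hw H0 Hr' H1) as [R1 [R2 R3]].
  destruct (expansion_divide _ _ _ _ Hw) as [w1 [Hw1 Ew1]].
  destruct (expansion_taylor3 _ _ _ _ Hw1) as [g [rg [K [Hrg [HK Eg]]]]].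
  destruct (expansion_taylor3 _ _ _ _ Hv) as [g' [rg' [K' [Hrg' [HK' Eg']]]]].
  set (G := fun y => g (RtoC u + Ci * RtoC y)%C).
  set (G' := fun y => g' (RtoC u + Ci * RtoC y)%C).
  apply (curvature_limit_coords (Im (e 1%nat)) (Im (e 2%nat)) (Im (e 3%nat))
    (fun y => Re (G y)) (fun y => Im (G y)) (fun y => Im (G' y)) (fun y => - Re (G' y))); trivial.
  - apply (bounded_right_of_C g (RtoC u) rg K); trivial. intros y. apply re_le_Cmod.
  - apply (bounded_right_of_C g (RtoC u) rg K); trivial. intros y. apply im_le_Cmod.
  - apply (bounded_right_of_C g' (RtoC u) rg' K'); trivial. intros y. apply im_le_Cmod.
  - apply bounded_right_opp.
    apply (bounded_right_of_C g' (RtoC u) rg' K'); trivial. intros y. apply re_le_Cmod.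
  - exists 1. split; [lra|]. intros y _.
    rewrite !Cmod2_alt, Ew1, Eg, Eg', H0.
    fold (G y). fold (G' y).
    replace (RtoC u + Ci * RtoC y - RtoC u)%C with (Ci * RtoC y)%C by ring.
    unfold dcoef. simpl (INR _).
    destruct (e 1%nat) as [p1 q1], (e 2%nat) as [p2 q2], (e 3%nat) as [p3 q3].
    destruct (G y) as [s t], (G' y) as [s' t']. simpl in *. subst p1 p2 p3.
    split; field.
Qed.

(** Multiplication by the unimodular constant [conj(B(u))] changes neither side
    and reduces to functions with value [1] at [u]. *)
Lemma curvature_limit B u r' :
  analytic_at B (RtoC u) -> C_derive B (RtoC u) <> RtoC 0 -> 0 < r' ->
  (forall x, u <= x < u + r' -> Cmod (B (RtoC x)) = 1) ->
  exists l, RtoC l = (/ RtoC 6 * schwarzian B (RtoC u))%C /\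
  filterlim (fun y => 1 / (4 * y ^ 2) - Cmod (C_derive B (RtoC u + Ci * RtoC y)%C) ^ 2 /
       (1 - Cmod (B (RtoC u + Ci * RtoC y)%C) ^ 2) ^ 2) (at_right 0) (locally l).
Proof.
  intros HB Hn Hr' H1.
  destruct (analytic_regular_near _ _ HB Hn) as [r1 [Hr1 HD]].
  rewrite (schwarzian_value B (RtoC u) r1 Hr1 HD).
  apply analytic_expansion in HB as [a [r Ha]].
  destruct (expansion_derive _ _ _ _ Ha) as [ra [Ha1 _]].
  destruct (expansion_derive _ _ _ _ Ha1) as [rb [Ha2 _]].
  destruct (expansion_derive _ _ _ _ Ha2) as [rc [Ha3 _]].
  pose proof (expansion_value _ _ _ _ Ha) as V0.
  pose proof (expansion_value _ _ _ _ Ha1) as V1.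
  pose proof (expansion_value _ _ _ _ Ha2) as V2.
  pose proof (expansion_value _ _ _ _ Ha3) as V3.
  set (c := Cconj (a 0%nat)).
  assert (Hc1 : Cmod c = 1).
  { unfold c. rewrite Cmod_conj, <- V0. apply H1. lra. }
  assert (Hc : (c * a 0%nat)%C = RtoC 1).
  { unfold c in *. rewrite Cmult_comm, <- Cmod2_conj, <- Cmod_conj, Hc1. f_equal. ring. }
  set (e := fun k => (c * a k)%C).
  assert (Hw : expansion (fun z => c * B z)%C (RtoC u) e r)
    by (apply (expansion_scal _ _ a); trivial).
  assert (Hv : expansion (fun z => c * C_derive B z)%C (RtoC u) (dcoef e) ra)
    by (apply (expansion_scal _ _ (dcoef a)); trivial; intros k; unfold dcoef, e; ring).
  assert (He0 : e 0%nat = RtoC 1) by exact Hc.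
  assert (Hu : forall x, u < x < u + r' -> Cmod (c * B (RtoC x))%C = 1).
  { intros x Hx. rewrite Cmod_mult, Hc1, H1 by lra. ring. }
  destruct (unimodular_coefs _ _ _ _ _ Hw He0 Hr' Hu) as [R1 [R2 R3]].
  assert (Hc0 : c <> RtoC 0) by (apply Cmod_gt_0; lra).
  assert (Hth : Im (e 1%nat) <> 0).
  { intros E. apply Hn. rewrite V1. unfold dcoef. simpl (INR 1).
    assert (E1 : e 1%nat = RtoC 0).
    { rewrite (surjective_pairing (e 1%nat)). unfold RtoC. f_equal; assumption. }
    replace (RtoC 1 * a 1%nat)%C with (/ c * e 1%nat)%C by (unfold e; field; trivial).
    rewrite E1. ring. }
  eexists. split; cycle 1.
  - generalize (curvature_limit_unit _ _ _ _ _ _ _ Hw Hv He0 Hr' Hu Hth).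
    apply filterlim_ext. intros y. rewrite !Cmod_mult, Hc1, !Rmult_1_l. reflexivity.
  - rewrite V1, V2, V3. unfold dcoef.
    assert (Ea : forall k, a k = (/ c * e k)%C) by (intros k; unfold e; field; trivial).
    rewrite !Ea. clearbody e.
    set (th := Im (e 1%nat)) in *. set (be := Im (e 2%nat)) in *. set (ga := Im (e 3%nat)) in *.
    assert (Hn1 : e 1%nat <> RtoC 0).
    { intros E. apply Hth. unfold th. rewrite E. reflexivity. }
    assert (E2 : (e 2%nat / e 1%nat)%C = (RtoC (be / th) + Ci * RtoC (th / 2))%C).
    { assert (E : e 2%nat = ((RtoC (be / th) + Ci * RtoC (th / 2)) * e 1%nat)%C).
      { apply injective_projections; simpl;
          change (fst (e 1%nat)) with (Re (e 1%nat)); change (snd (e 1%nat)) with th;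
          change (fst (e 2%nat)) with (Re (e 2%nat)); change (snd (e 2%nat)) with be;
          rewrite ?R1, ?R2; field; trivial. }
      rewrite E. field. exact Hn1. }
    assert (E3 : (e 3%nat / e 1%nat)%C = (RtoC (ga / th) + Ci * RtoC be)%C).
    { assert (E : e 3%nat = ((RtoC (ga / th) + Ci * RtoC be) * e 1%nat)%C).
      { apply injective_projections; simpl;
          change (fst (e 1%nat)) with (Re (e 1%nat)); change (snd (e 1%nat)) with th;
          change (fst (e 3%nat)) with (Re (e 3%nat)); change (snd (e 3%nat)) with ga;
          rewrite ?R1, ?R3; field; trivial. }
      rewrite E. field. exact Hn1. }
    transitivity (e 3%nat / e 1%nat - (e 2%nat / e 1%nat) * (e 2%nat / e 1%nat))%C.
    + rewrite E2, E3. apply injective_projections; simpl; field; trivial.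
    + simpl (INR _). rewrite !RtoC_plus. field. auto.
Qed.

(** * Inner products and orthogonal projections *)

Section Inner.
Context {H : HilbertSpace}.
Implicit Types x y z : H.

Lemma inner_plus_r x y z : inner x (plus y z) = (inner x y + inner x z)%C.
Proof. rewrite inner_conj, inner_plus_l, Cplus_conj, <- !inner_conj. reflexivity. Qed.

Lemma inner_scal_r (c : C) x y : inner x (scal c y) = (Cconj c * inner x y)%C.
Proof. rewrite inner_conj, inner_scal_l, Cmult_conj, <- inner_conj. reflexivity. Qed.

Lemma inner_opp_l x y : inner (opp x) y = (- inner x y)%C.
Proof.
  replace (opp x) with (scal (- RtoC 1)%C x)
    by exact (scal_opp_one (K := C_AbsRing) x).
  rewrite inner_scal_l. ring.
Qed.

Lemma inner_opp_r x y : inner x (opp y) = (- inner x y)%C.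
Proof. rewrite inner_conj, inner_opp_l, Copp_conj, <- inner_conj. reflexivity. Qed.

Lemma inner_minus_l x y z : inner (minus x y) z = (inner x z - inner y z)%C.
Proof. unfold minus. rewrite inner_plus_l, inner_opp_l. reflexivity. Qed.

Lemma inner_minus_r x y z : inner x (minus y z) = (inner x y - inner x z)%C.
Proof. unfold minus. rewrite inner_plus_r, inner_opp_r. reflexivity. Qed.

Lemma inner_zero_l x : inner zero x = RtoC 0.
Proof.
  replace (zero : H) with (scal (RtoC 0) x)
    by exact (scal_zero_l (K := C_AbsRing) x).
  rewrite inner_scal_l. ring.
Qed.

Lemma inner_zero_r x : inner x zero = RtoC 0.
Proof. rewrite inner_conj, inner_zero_l. unfold Cconj, RtoC. simpl. f_equal. ring. Qed.

(** Turns linear identities between vectors into ring identities in [C]. *)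
Lemma inner_ext x y : (forall z, inner x z = inner y z) -> x = y.
Proof.
  intros E.
  assert (N : norm (minus x y) * norm (minus x y) = 0).
  { apply RtoC_inj. rewrite <- inner_norm, inner_minus_l, E. ring. }
  assert (N0 : norm (minus x y) = 0) by nra.
  apply norm_eq_zero in N0.
  apply (plus_reg_r (opp y)). now rewrite plus_opp_r.
Qed.
End Inner.

Ltac inner_expand :=
  repeat first [ rewrite inner_plus_l | rewrite inner_plus_r | rewrite inner_minus_l
    | rewrite inner_minus_r | rewrite inner_scal_l | rewrite inner_scal_r
    | rewrite inner_opp_l | rewrite inner_opp_r | rewrite inner_zero_l | rewrite inner_zero_r ].

Ltac vector := apply inner_ext; let z := fresh in intros z; inner_expand; ring.

Section Hilbert.
Context {H : HilbertSpace}.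
Implicit Types x y z : H.

Lemma norm_scal_C (c : C) x : norm (scal c x) <= Cmod c * norm x.
Proof. exact (norm_scal (K := C_AbsRing) (V := H) c x). Qed.

Lemma norm_plus_le x y : norm (plus x y) <= norm x + norm y.
Proof. exact (norm_triangle (K := C_AbsRing) (V := H) x y). Qed.

Lemma norm_sq x : norm x * norm x = Re (inner x x).
Proof. now rewrite inner_norm. Qed.

Lemma norm_minus_triangle x y z : norm (minus x z) <= norm (minus x y) + norm (minus y z).
Proof.
  replace (minus x z) with (plus (minus x y) (minus y z)) by vector. apply norm_plus_le.
Qed.

Lemma re_inner_le x y : Re (inner x y) <= norm x * norm y.
Proof.
  pose proof (norm_plus_le x y) as Ht.
  pose proof (norm_ge_0 (plus x y)). pose proof (norm_ge_0 x). pose proof (norm_ge_0 y).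
  assert (E : norm (plus x y) * norm (plus x y) =
    norm x * norm x + 2 * Re (inner x y) + norm y * norm y).
  { rewrite !norm_sq. inner_expand. rewrite (inner_conj _ x y).
    destruct (inner x y) as [p q]. simpl. unfold Re. ring. }
  nra.
Qed.

(** The triangle inequality of the norm already bounds the real part; the phase
    of [inner x y] is absorbed into [x]. *)
Lemma cauchy_schwarz x y : Cmod (inner x y) <= norm x * norm y.
Proof.
  destruct (Req_dec (Cmod (inner x y)) 0) as [E|E].
  { rewrite E. apply Rmult_le_pos; apply norm_ge_0. }
  assert (Hp : 0 < Cmod (inner x y)) by (pose proof (Cmod_ge_0 (inner x y)); lra).
  pose proof (re_inner_le (scal (Cconj (inner x y)) x) y) as Hr.
  rewrite inner_scal_l, Cmult_comm, <- Cmod2_conj in Hr.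
  pose proof (norm_scal_C (Cconj (inner x y)) x) as Hn. rewrite Cmod_conj in Hn.
  pose proof (norm_ge_0 y). unfold Re, RtoC in Hr. simpl in Hr.
  apply Rmult_le_reg_l with (Cmod (inner x y)); trivial.
  assert (norm (scal (Cconj (inner x y)) x) * norm y <= Cmod (inner x y) * norm x * norm y)
    by now apply Rmult_le_compat_r.
  lra.
Qed.

Lemma norm_zero_inner x : norm x = 0 -> x = zero.
Proof. exact (norm_eq_zero (K := C_AbsRing) (V := H) x). Qed.

Definition tends (s : nat -> H) x : Prop :=
  forall eps, 0 < eps -> exists N, forall n, (N <= n)%nat -> norm (minus (s n) x) < eps.

Lemma cauchy_tends (s : nat -> H) :
  (forall eps, 0 < eps -> exists N, forall n m, (N <= n)%nat -> (N <= m)%nat ->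
     norm (minus (s n) (s m)) < eps) -> exists x, tends s x.
Proof.
  intros Hs.
  destruct (proj1 (filterlim_locally_cauchy (U := H) (F := eventually) s)) as [x Hx].
  - intros eps. destruct (Hs eps (cond_pos eps)) as [N HN].
    exists (fun n => (N <= n)%nat). split; [now exists N|].
    intros n m Hn Hm. apply (norm_compat1 (K := C_AbsRing) (V := H)). now apply HN.
  - exists x. intros eps He.
    apply (Hx (fun y => norm (minus y x) < eps)).
    apply (locally_le_locally_norm (K := C_AbsRing) (V := H)). now exists (mkposreal eps He).
Qed.

Lemma tends_ball (s : nat -> H) x (eps : posreal) :
  tends s x -> exists N, forall n, (N <= n)%nat -> ball x eps (s n).
Proof.
  intros Hs. destruct (Hs eps (cond_pos eps)) as [N HN]. exists N. intros n Hn.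
  apply (norm_compat1 (K := C_AbsRing) (V := H)). now apply HN.
Qed.

(** A minimizing sequence for the distance from [v] to [L] is Cauchy by the
    parallelogram law, and the minimizer is orthogonal by the usual variation.
    The completeness of [L] is stated with sequences, as this is what closedness
    of an operator provides. *)
Lemma orthogonal_projection (L : H -> Prop) (v : H) :
  is_subspace L ->
  (forall s : nat -> H, (forall n, L (s n)) ->
     (forall eps, 0 < eps -> exists N, forall n m, (N <= n)%nat -> (N <= m)%nat ->
        norm (minus (s n) (s m)) < eps) -> exists x, L x /\ tends s x) ->
  exists w, L w /\ orth L (minus v w).
Proof.
  intros [L0 [Lp Ls]] Lc.
  (* The distance from [v] to [L], as minus the supremum of opposites. *)
  destruct (completeness (fun r => exists l, L l /\ r = - norm (minus v l))) as [D' [HD1 HD2]].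
  { exists 0. intros r [l [_ ->]]. pose proof (norm_ge_0 (minus v l)). lra. }
  { exists (- norm (minus v zero)). now exists zero. }
  set (D := - D').
  assert (Dlow : forall l, L l -> D <= norm (minus v l)).
  { intros l Hl. assert (- norm (minus v l) <= D') by (apply HD1; now exists l). unfold D. lra. }
  assert (D0 : 0 <= D).
  { assert (D' <= 0); [|unfold D; lra]. apply HD2. intros r [l [_ ->]].
    pose proof (norm_ge_0 (minus v l)). lra. }
  assert (Dapp : forall n : nat, exists l, L l /\ norm (minus v l) < D + / INR (S n)).
  { intros n. apply NNPP. intros Hn.
    assert (0 < / INR (S n)) by (apply Rinv_0_lt_compat, lt_0_INR; lia).
    assert (D' <= D' - / INR (S n)); [|lra].
    apply HD2. intros r [l [Hl ->]].
    destruct (Rlt_dec (norm (minus v l)) (D + / INR (S n))) as [Hlt|Hge].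
    - exfalso. apply Hn. now exists l.
    - unfold D in Hge. lra. }
  set (s := fun n => proj1_sig (constructive_indefinite_description _ (Dapp n))).
  assert (Hs : forall n, L (s n) /\ norm (minus v (s n)) < D + / INR (S n)).
  { intros n. unfold s. apply proj2_sig. }
  clearbody s.
  assert (small : forall eps, 0 < eps -> exists N, forall n, (N <= n)%nat -> / INR (S n) < eps).
  { intros eps He. destruct (archimed_cor1 eps He) as [N [HN1 HN2]]. exists N. intros n Hn.
    eapply Rle_lt_trans; [|exact HN1]. apply Rinv_le_contravar; [now apply lt_0_INR|].
    apply le_INR. lia. }
  destruct (Lc s) as [w [Lw Hw]].
  { intros n. apply Hs. }
  { intros eps He.
    set (d := Rmin 1 (eps * eps / (8 * D + 8))).
    assert (He2 : 0 < eps * eps) by nra.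
    assert (Hd : 0 < d).
    { apply Rmin_pos; [lra|]. apply Rdiv_lt_0_compat; lra. }
    assert (Hd1 : d <= 1) by apply Rmin_l.
    assert (Hd2 : d * (8 * D + 8) <= eps * eps).
    { apply Rle_div_r; [lra|]. apply Rmin_r. }
    destruct (small d Hd) as [N HN]. exists N. intros n m Hn Hm.
    destruct (Hs n) as [Ln Hn1], (Hs m) as [Lm Hm1].
    specialize (HN n Hn) as HNn. specialize (HN m Hm) as HNm.
    set (mid := scal (RtoC (1 / 2)) (plus (s n) (s m))).
    assert (Hmid : D <= norm (minus v mid)) by (apply Dlow, Ls, Lp; trivial).
    assert (P : norm (minus (s n) (s m)) * norm (minus (s n) (s m)) =
      2 * (norm (minus v (s n)) * norm (minus v (s n))) +
      2 * (norm (minus v (s m)) * norm (minus v (s m))) -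
      4 * (norm (minus v mid) * norm (minus v mid))).
    { apply RtoC_inj. unfold mid. rewrite !RtoC_minus, !RtoC_plus, !(RtoC_mult 2), !(RtoC_mult 4).
      rewrite <- !inner_norm. inner_expand.
      replace (Cconj (RtoC (1 / 2))) with (RtoC (1 / 2))
        by (unfold Cconj, RtoC; simpl; f_equal; ring).
      replace (RtoC (1 / 2)) with (/ RtoC 2)%C by (apply injective_projections; simpl; field).
      field. }
    pose proof (norm_ge_0 (minus v (s n))). pose proof (norm_ge_0 (minus v (s m))).
    pose proof (norm_ge_0 (minus (s n) (s m))).
    assert (norm (minus (s n) (s m)) * norm (minus (s n) (s m)) < eps * eps).
    { rewrite P. nra. }
    nra. }
  exists w. split; trivial.
  assert (Dw : norm (minus v w) <= D).
  { apply le_epsilon. intros eps He.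
    destruct (Hw (eps / 2)) as [N1 HN1]; [lra|]. destruct (small (eps / 2)) as [N2 HN2]; [lra|].
    set (n := max N1 N2). specialize (HN1 n ltac:(lia)). specialize (HN2 n ltac:(lia)).
    destruct (Hs n) as [_ Hn]. pose proof (norm_minus_triangle v (s n) w). lra. }
  intros l Ll. set (x := minus v w : H) in *. set (c := inner x l).
  pose proof (norm_ge_0 l) as Hl0.
  (* Any [t] with [0 < t] and [t |l|^2 <= 1] makes the variation [t c l] decrease
     the distance unless [c = 0]. *)
  set (t := / (norm l * norm l + 1)).
  assert (Ht : 0 < t) by (apply Rinv_0_lt_compat; nra).
  assert (Htl : t * (norm l * norm l) <= 1).
  { unfold t. rewrite Rmult_comm. apply Rle_div_l; nra. }
  assert (Hmin : norm x <= norm (minus x (scal (RtoC t * c)%C l))).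
  { eapply Rle_trans; [exact Dw|].
    replace (minus x (scal (RtoC t * c)%C l)) with (minus v (plus w (scal (RtoC t * c)%C l)))
      by (unfold x; vector).
    apply Dlow, Lp; trivial. now apply Ls. }
  pose proof (norm_ge_0 x) as Hx0.
  assert (Hsq : norm x * norm x <= norm (minus x (scal (RtoC t * c)%C l)) *
     norm (minus x (scal (RtoC t * c)%C l))) by nra.
  assert (E : norm (minus x (scal (RtoC t * c)%C l)) * norm (minus x (scal (RtoC t * c)%C l)) =
    norm x * norm x - 2 * t * Cmod c ^ 2 + t * (t * (norm l * norm l)) * Cmod c ^ 2).
  { rewrite (norm_sq (minus x (scal (RtoC t * c)%C l))). inner_expand.
    rewrite (inner_conj _ x l). fold c.
    rewrite !inner_norm, Cmod2_alt. destruct c as [p q]. simpl. ring. }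
  rewrite E in Hsq.
  assert (Hc : 0 <= Cmod c ^ 2) by apply pow2_ge_0.
  apply Cmod_eq_0. assert (Cmod c ^ 2 <= 0); [|nra].
  assert (t * (t * (norm l * norm l)) <= t) by nra.
  assert (t * Cmod c ^ 2 <= 0) by nra. nra.
Qed.
End Hilbert.

(** * Weyl vectors of an entire operator *)

Section Ops.
Context {H : HilbertSpace} (T : operator H).

Lemma op_plus x y : dom T x -> dom T y -> T (plus x y) = plus (T x) (T y).
Proof. apply (op_linear H T). Qed.

Lemma op_scal (c : C) x : dom T x -> T (scal c x) = scal c (T x).
Proof. apply (op_linear H T). Qed.

Lemma dom_minus x y : dom T x -> dom T y -> dom T (minus x y) /\ T (minus x y) = minus (T x) (T y).
Proof.
  intros Hx Hy. destruct (dom_subspace H T) as [_ [Dp Ds]].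
  assert (E : forall a b : H, minus a b = plus a (scal (- RtoC 1)%C b)) by (intros; vector).
  rewrite !E. split.
  - apply Dp; trivial. now apply Ds.
  - rewrite op_plus, op_scal; trivial. now apply Ds.
Qed.

Lemma graph_in_orth : is_symmetric T -> forall x, graph T x -> graph_orth T x.
Proof.
  intros Hs [x1 x2] [Hx1 Hx2] [y1 y2] [Hy1 Hy2]. unfold cform. simpl in *. subst.
  rewrite Hs by trivial. ring.
Qed.

Lemma cform_plus_l (a b y : H * H) : cform (plus a b) y = (cform a y + cform b y)%C.
Proof.
  destruct a as [a1 a2], b as [b1 b2]. unfold cform.
  change (plus (a1, a2) (b1, b2)) with (plus a1 b1, plus a2 b2). simpl.
  inner_expand. ring.
Qed.

Lemma cform_scal_l (c : C) (a y : H * H) : cform (scal c a) y = (c * cform a y)%C.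
Proof.
  destruct a as [a1 a2]. unfold cform.
  change (scal c (a1, a2)) with (scal c a1, scal c a2). simpl.
  inner_expand. ring.
Qed.

Lemma graph_orth_plus a b : graph_orth T a -> graph_orth T b -> graph_orth T (plus a b).
Proof. intros Ha Hb y Hy. rewrite cform_plus_l, Ha, Hb by trivial. ring. Qed.

Lemma graph_orth_scal c a : graph_orth T a -> graph_orth T (scal c a).
Proof. intros Ha y Hy. rewrite cform_scal_l, Ha by trivial. ring. Qed.

(** The lower bound makes the inverse of [T - mu] bounded, so a Cauchy sequence in the
    range lifts to a Cauchy sequence in the graph, which is closed. *)
Lemma range_complete (mu : C) (c : R) :
  is_closed T -> 0 < c ->
  (forall x, dom T x -> c * norm x <= norm (minus (T x) (scal mu x))) ->
  let L := fun w => exists y, dom T y /\ w = minus (T y) (scal mu y) in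
  forall s : nat -> H, (forall n, L (s n)) ->
     (forall eps, 0 < eps -> exists N, forall n m, (N <= n)%nat -> (N <= m)%nat ->
        norm (minus (s n) (s m)) < eps) -> exists x, L x /\ tends s x.
Proof.
  intros Hcl Hc Hreg L s Hs Hcau.
  destruct (cauchy_tends s Hcau) as [w Hw].
  set (y := fun n => proj1_sig (ClassicalEpsilon.constructive_indefinite_description _ (Hs n))).
  assert (Hy : forall n, dom T (y n) /\ s n = minus (T (y n)) (scal mu (y n))).
  { intros n. unfold y. apply proj2_sig. }
  clearbody y.
  destruct (cauchy_tends y) as [y0 Hy0].
  { intros eps He. destruct (Hcau (c * eps)) as [N HN]; [now apply Rmult_lt_0_compat|].
    exists N. intros n m Hn Hm. specialize (HN n m Hn Hm).
    destruct (Hy n) as [D1 E1], (Hy m) as [D2 E2].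
    destruct (dom_minus _ _ D1 D2) as [D3 E3].
    specialize (Hreg _ D3). rewrite E3 in Hreg.
    replace (minus (minus (T (y n)) (T (y m))) (scal mu (minus (y n) (y m))))
      with (minus (s n) (s m)) in Hreg by (rewrite E1, E2; vector).
    apply Rmult_lt_reg_l with c; lra. }
  assert (HT : tends (fun n => T (y n)) (plus w (scal mu y0))).
  { intros eps He.
    pose proof (Cmod_ge_0 mu) as Hmu.
    destruct (Hw (eps / 2)) as [N1 H1]; [lra|].
    destruct (Hy0 (eps / 2 / (Cmod mu + 1))) as [N2 H2]; [apply Rdiv_lt_0_compat; lra|].
    exists (max N1 N2). intros n Hn. specialize (H1 n ltac:(lia)). specialize (H2 n ltac:(lia)).
    destruct (Hy n) as [_ E].
    replace (minus (T (y n)) (plus w (scal mu y0)))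
      with (plus (minus (s n) w) (scal mu (minus (y n) y0))) by (rewrite E; vector).
    eapply Rle_lt_trans; [apply norm_plus_le|].
    pose proof (norm_scal_C mu (minus (y n) y0)) as H3.
    apply Rlt_div_r in H2; [|lra].
    pose proof (norm_ge_0 (minus (y n) y0)). nra. }
  assert (G : graph T (y0, plus w (scal mu y0))).
  { apply Hcl. intros [eps Hloc].
    destruct (tends_ball _ _ eps Hy0) as [N1 H1]. destruct (tends_ball _ _ eps HT) as [N2 H2].
    apply (Hloc (y (max N1 N2), T (y (max N1 N2)))).
    - split; simpl; [apply H1 | apply H2]; lia.
    - split; [apply Hy | reflexivity]. }
  destruct G as [G1 G2]. simpl in G1, G2.
  exists w. split; trivial. exists y0. split; trivial. rewrite <- G2. vector.
Qed.

Lemma subspace_intro (L : H -> Prop) :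
  L (zero : H) -> (forall x y : H, L x -> L y -> L (plus x y)) ->
  (forall (c : C) (x : H), L x -> L (scal c x)) -> is_subspace L.
Proof. intros L0 Lp Ls. split; [exact L0 | split; [exact Lp | exact Ls]]. Qed.

Lemma range_subspace (mu : C) :
  is_subspace (fun w => exists y, dom T y /\ w = minus (T y) (scal mu y)).
Proof.
  destruct (dom_subspace H T) as [D0 [Dp Ds]]. apply subspace_intro.
  - exists zero. split; trivial.
    assert (E : T zero = zero).
    { replace (zero : H) with (scal (RtoC 0) (zero : H)) by vector.
      rewrite op_scal by trivial. vector. }
    rewrite E. vector.
  - intros x y [a [Ha ->]] [b [Hb ->]]. exists (plus a b). split; [now apply Dp|].
    rewrite op_plus by trivial. vector.
  - intros c x [a [Ha ->]]. exists (scal c a). split; [now apply Ds|].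
    rewrite op_scal by trivial. vector.
Qed.

Context (HT : entire_1_1 T).

Section Triplet.
Context (Gp Gm : H * H -> C) (HG : boundary_triplet T Gp Gm).

(** Green's identity on [W_lambda], where the boundary form of
    [(x, lambda x)] with itself is [2 i Im(lambda) |x|^2]. *)
Lemma weyl_norm_identity lambda a :
  Wspace T lambda a ->
  Cmod (Gp a) ^ 2 - Cmod (Gm a) ^ 2 = 2 * Im lambda * (norm (fst a) * norm (fst a)).
Proof.
  intros [Ha Ea]. pose proof (triplet_green T Gp Gm HG a a Ha Ha) as E.
  unfold cform in E. rewrite Ea in E. revert E. inner_expand. rewrite inner_norm.
  intros E. apply (f_equal snd) in E. rewrite !Cmod2_alt.
  destruct (Gp a) as [p q], (Gm a) as [p' q'], lambda as [l1 l2]. simpl in *. lra.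
Qed.

(** Project a boundary vector [e] with [Gamma_+ e = 1], [Gamma_- e = 0] along the
    range of [T - conj(lambda)].  The component [x] orthogonal to the range gives
    [(x, lambda x)] in the space [W_lambda].  If it were zero, [e] would agree
    modulo the graph with a vector of [W_(conj lambda)], on which the form has the
    wrong sign. *)
Lemma weyl_vector_exists lambda :
  0 < Im lambda -> exists a, Wspace T lambda a /\ fst a <> zero.
Proof.
  intros Hl. set (mu := Cconj lambda).
  destruct (triplet_surj T Gp Gm HG (RtoC 1) (RtoC 0)) as [e [He [Hep Hem]]].
  destruct (entire_regular T HT mu) as [c [Hc Hreg]].
  destruct (orthogonal_projection _ (minus (snd e) (scal mu (fst e))) (range_subspace mu)
    (range_complete mu c (entire_closed T HT) Hc Hreg)) as [w [[y [Dy ->]] Horth]].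
  set (x := minus (minus (snd e) (scal mu (fst e))) (minus (T y) (scal mu y)) : H) in *.
  exists (x, scal lambda x). split.
  - split; [|reflexivity]. intros [z1 z2] [Dz Ez]. unfold cform. simpl in *. subst z2.
    pose proof (Horth (minus (T z1) (scal mu z1)) (ex_intro _ z1 (conj Dz eq_refl))) as E.
    revert E. inner_expand. unfold mu. rewrite Cconj_conj. intros E.
    transitivity (- (inner x (T z1) - lambda * inner x z1))%C; [ring|]. rewrite E. ring.
  - simpl. intros Hx0.
    set (t := (y, T y)).
    assert (Gt : graph T t) by (split; [exact Dy | reflexivity]).
    pose proof (graph_in_orth (entire_symmetric T HT) t Gt) as Ot.
    (* The vector [e] moved along the graph into [W_(conj lambda)]. *)
    set (b := plus e (scal (- RtoC 1)%C t)).
    assert (Ost : graph_orth T (scal (- RtoC 1)%C t)) by now apply graph_orth_scal.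
    assert (Ob : graph_orth T b) by (apply graph_orth_plus; trivial).
    destruct (triplet_vanish T Gp Gm HG t Gt) as [Vp Vm].
    destruct (triplet_linear_p T Gp Gm HG) as [Lp Sp].
    destruct (triplet_linear_m T Gp Gm HG) as [Lm Sm].
    assert (Bp : Gp b = RtoC 1).
    { unfold b. rewrite Lp, Sp, Vp, Hep by trivial.
      change (RtoC 1 + (- RtoC 1) * RtoC 0 = RtoC 1)%C. ring. }
    assert (Bm : Gm b = RtoC 0).
    { unfold b. rewrite Lm, Sm, Vm, Hem by trivial.
      change (RtoC 0 + (- RtoC 1) * RtoC 0 = RtoC 0)%C. ring. }
    assert (Wb : Wspace T mu b).
    { split; trivial. unfold b, t. destruct e as [e1 e2].
      change (plus e2 (scal (- RtoC 1)%C (T y)) = scal mu (plus e1 (scal (- RtoC 1)%C y))).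
      simpl in x.
      transitivity (plus x (scal mu (plus e1 (scal (- RtoC 1)%C y)))); [unfold x; vector|].
      rewrite Hx0. vector. }
    pose proof (weyl_norm_identity mu b Wb) as E.
    rewrite Bp, Bm, Cmod_1, Cmod_0 in E. unfold mu in E. rewrite im_conj in E.
    assert (0 <= norm (fst b) * norm (fst b)) by nra. nra.
Qed.

Lemma contractive_weyl_identity B lambda a :
  contractive_weyl_function T Gp Gm B -> 0 < Im lambda -> Wspace T lambda a ->
  (1 - Cmod (B lambda) ^ 2) * Cmod (Gp a) ^ 2 = 2 * Im lambda * (norm (fst a) * norm (fst a)).
Proof.
  intros [_ HB] Hl Ha. rewrite <- (weyl_norm_identity lambda a Ha), (HB lambda a Hl Ha), Cmod_mult.
  ring.
Qed.

Lemma weyl_vector_Gp B lambda :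
  contractive_weyl_function T Gp Gm B -> 0 < Im lambda ->
  exists a, Wspace T lambda a /\ fst a <> zero /\ Gp a <> RtoC 0.
Proof.
  intros HB Hl. destruct (weyl_vector_exists lambda Hl) as [a [Ha Hx]].
  exists a. repeat split; try apply Ha; trivial.
  intros E. pose proof (contractive_weyl_identity B lambda a HB Hl Ha) as E1.
  rewrite E, Cmod_0 in E1.
  assert (norm (fst a) * norm (fst a) = 0).
  { apply Rmult_eq_reg_l with (2 * Im lambda); [|lra]. rewrite <- E1. ring. }
  apply Hx, norm_zero_inner. nra.
Qed.

(** For [e] with boundary values [(1, 0)], Green's identity expresses [Gamma_+ a]
    as a boundary form with [e], so [Gamma_+] is bounded on [W_lambda]. *)
Lemma contractive_lower_bound B (u : R) :
  contractive_weyl_function T Gp Gm B ->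
  exists c, 0 < c /\ forall lambda, 0 < Im lambda -> Cmod (lambda - RtoC u) < 1 ->
    c * Im lambda <= 1 - Cmod (B lambda) ^ 2.
Proof.
  intros HB.
  destruct (triplet_surj T Gp Gm HG (RtoC 1) (RtoC 0)) as [e [He [Hep Hem]]].
  set (K := (Cmod (RtoC u) + 1) * norm (fst e) + norm (snd e) + 1).
  assert (HK : 0 < K).
  { unfold K. pose proof (Cmod_ge_0 (RtoC u)). pose proof (norm_ge_0 (fst e)).
    pose proof (norm_ge_0 (snd e)). nra. }
  exists (2 / (K * K)). split; [apply Rdiv_lt_0_compat; nra|].
  intros lambda Hl Hlu.
  destruct (weyl_vector_Gp B lambda HB Hl) as [a [Ha [Hx Hp]]].
  pose proof (contractive_weyl_identity B lambda a HB Hl Ha) as E1.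
  assert (Hlam : Cmod lambda <= Cmod (RtoC u) + 1).
  { replace lambda with (RtoC u + (lambda - RtoC u))%C by ring.
    eapply Rle_trans; [apply Cmod_triangle | lra]. }
  assert (Hb : Cmod (Gp a) <= K * norm (fst a)).
  { pose proof (triplet_green T Gp Gm HG a e (proj1 Ha) He) as E.
    rewrite Hep, Hem in E.
    replace (Ci * Gp a * Cconj (RtoC 1) - Ci * Gm a * Cconj (RtoC 0))%C with (Ci * Gp a)%C in E
      by (apply injective_projections; simpl; ring).
    rewrite <- (Rmult_1_l (Cmod (Gp a))), <- Cmod_Ci, <- Cmod_mult, <- E.
    unfold cform, Cminus. rewrite (proj2 Ha), inner_scal_l.
    eapply Rle_trans; [apply Cmod_triangle|]. rewrite Cmod_opp, Cmod_mult.
    pose proof (cauchy_schwarz (fst a) (fst e)). pose proof (cauchy_schwarz (fst a) (snd e)).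
    pose proof (norm_ge_0 (fst a)). pose proof (norm_ge_0 (fst e)). pose proof (Cmod_ge_0 lambda).
    pose proof (Cmod_ge_0 (inner (fst a) (fst e))).
    assert (Cmod lambda * Cmod (inner (fst a) (fst e)) <=
      (Cmod (RtoC u) + 1) * (norm (fst a) * norm (fst e))) by (apply Rmult_le_compat; lra).
    unfold K. nra. }
  pose proof (Cmod_ge_0 (Gp a)) as HG0. apply Cmod_gt_0 in Hp.
  set (X := norm (fst a)) in *. set (P := Cmod (Gp a)) in *.
  apply Rmult_le_reg_r with (P ^ 2); [nra|]. rewrite E1.
  assert (P ^ 2 <= (K * K) * (X * X)) by nra.
  replace (2 / (K * K) * Im lambda * P ^ 2) with (2 * Im lambda * (P ^ 2 / (K * K)))
    by (field; lra).
  apply Rmult_le_compat_l; [lra|]. apply Rle_div_l; nra.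
Qed.

Lemma triplet_decomposition :
  exists e f, graph_orth T e /\ graph_orth T f /\
    forall a, graph_orth T a -> exists t, graph T t /\
      a = plus (plus (scal (Gp a) e) (scal (Gm a) f)) t.
Proof.
  destruct (triplet_surj T Gp Gm HG (RtoC 1) (RtoC 0)) as [e [He [Hep Hem]]].
  destruct (triplet_surj T Gp Gm HG (RtoC 0) (RtoC 1)) as [f [Hf [Hfp Hfm]]].
  exists e, f. split; [|split]; trivial. intros a Ha.
  destruct (triplet_linear_p T Gp Gm HG) as [Lp Sp].
  destruct (triplet_linear_m T Gp Gm HG) as [Lm Sm].
  exists (plus a (plus (scal (- Gp a)%C e) (scal (- Gm a)%C f))).
  assert (He' : forall c, graph_orth T (scal c e)) by (intros; now apply graph_orth_scal).
  assert (Hf' : forall c, graph_orth T (scal c f)) by (intros; now apply graph_orth_scal).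
  assert (Hef : graph_orth T (plus (scal (- Gp a)%C e) (scal (- Gm a)%C f)))
    by (apply graph_orth_plus; trivial).
  split.
  - apply (triplet_inj T Gp Gm HG).
    + now apply graph_orth_plus.
    + rewrite !Lp, !Sp, Hep, Hfp by trivial.
      change (Gp a + ((- Gp a) * RtoC 1 + (- Gm a) * RtoC 0) = RtoC 0)%C. ring.
    + rewrite !Lm, !Sm, Hem, Hfm by trivial.
      change (Gm a + ((- Gp a) * RtoC 0 + (- Gm a) * RtoC 1) = RtoC 0)%C. ring.
  - generalize (Gp a) (Gm a). intros p m. destruct a as [a1 a2], e as [e1 e2], f as [f1 f2].
    apply injective_projections.
    + change (a1 = plus (plus (scal p e1) (scal m f1))
        (plus a1 (plus (scal (- p)%C e1) (scal (- m)%C f1)))). vector.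
    + change (a2 = plus (plus (scal p e2) (scal m f2))
        (plus a2 (plus (scal (- p)%C e2) (scal (- m)%C f2)))). vector.
Qed.

(** Subtracting the boundary part of [a = (x, lambda x)] leaves an element
    [(y, T y)] of the graph with [|(T - u) y| <= |lambda - u| |x| + K |Gamma_+ a|].
    Regularity at [u] bounds [|y|] by this, and the term [|lambda - u| |x|] is
    absorbed on the left for [lambda] close to [u]. *)
Lemma contractive_upper_bound B (u : R) :
  contractive_weyl_function T Gp Gm B ->
  exists r K, 0 < r /\ forall lambda, 0 < Im lambda -> Cmod (lambda - RtoC u) < r ->
    0 <= 1 - Cmod (B lambda) ^ 2 <= K * Im lambda.
Proof.
  intros HB. destruct triplet_decomposition as [e [f [He [Hf Hdec]]]].
  destruct (entire_regular T HT (RtoC u)) as [c [Hc Hreg]].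
  set (K1 := norm (fst e) + norm (fst f)).
  set (ue := minus (snd e) (scal (RtoC u) (fst e)) : H).
  set (uf := minus (snd f) (scal (RtoC u) (fst f)) : H).
  set (K := 2 / c * (c * K1 + norm ue + norm uf)).
  exists (c / 2), (2 * (K * K)). split; [lra|].
  intros lambda Hl Hlu.
  destruct (weyl_vector_Gp B lambda HB Hl) as [a [Ha [Hx Hp]]].
  pose proof (contractive_weyl_identity B lambda a HB Hl Ha) as E1.
  apply Cmod_gt_0 in Hp.
  assert (H0 : 0 <= 1 - Cmod (B lambda) ^ 2).
  { apply Rmult_le_reg_r with (Cmod (Gp a) ^ 2); [nra|]. rewrite E1.
    pose proof (norm_ge_0 (fst a)). rewrite Rmult_0_l.
    apply Rmult_le_pos; nra. }
  split; trivial.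
  assert (Hqp : Cmod (Gm a) <= Cmod (Gp a)).
  { pose proof (Cmod_ge_0 (B lambda)). pose proof (Cmod_ge_0 (Gm a)).
    rewrite (proj2 HB lambda a Hl Ha), Cmod_mult. assert (Cmod (B lambda) <= 1) by nra. nra. }
  destruct (Hdec a (proj1 Ha)) as [t [[Dt Et] Ea]].
  assert (Hb : norm (fst a) <= K * Cmod (Gp a)).
  { specialize (Hreg (fst t) Dt). rewrite <- Et in Hreg.
    destruct Ha as [_ Wa].
    destruct a as [a1 a2], t as [t1 t2], e as [e1 e2], f as [f1 f2].
    set (p := Gp (a1, a2)) in *. set (q := Gm (a1, a2)) in *. simpl in *.
    assert (Ea1 : a1 = plus (plus (scal p e1 : H) (scal q f1)) t1) by exact (f_equal fst Ea).
    assert (Ea2 : a2 = plus (plus (scal p e2 : H) (scal q f2)) t2) by exact (f_equal snd Ea).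
    assert (Et1 : t1 = minus a1 (plus (scal p e1 : H) (scal q f1)))
      by (rewrite Ea1; vector).
    assert (Et2 : minus t2 (scal (RtoC u) t1) =
      minus (scal (lambda - RtoC u)%C a1 : H) (plus (scal p ue : H) (scal q uf))).
    { unfold ue, uf.
      replace t2 with (minus a2 (plus (scal p e2 : H) (scal q f2)) : H) by (rewrite Ea2; vector).
      rewrite Wa, Et1. vector. }
    rewrite Et2 in Hreg.
    assert (N1 : norm a1 <= norm t1 + Cmod p * K1).
    { replace a1 with (plus (plus (scal p e1 : H) (scal q f1)) t1) by (symmetry; exact Ea1).
      eapply Rle_trans; [apply norm_plus_le|].
      pose proof (norm_plus_le (scal p e1) (scal q f1)).
      pose proof (norm_scal_C p e1). pose proof (norm_scal_C q f1).
      pose proof (norm_ge_0 f1). unfold K1. nra. }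
    assert (N2 :
       norm (minus (scal (lambda - RtoC u)%C a1 : H) (plus (scal p ue : H) (scal q uf))) <=
       Cmod (lambda - RtoC u) * norm a1 + Cmod p * (norm ue + norm uf)).
    { replace (minus (scal (lambda - RtoC u)%C a1 : H) (plus (scal p ue : H) (scal q uf))) with
        (plus (scal (lambda - RtoC u)%C a1 : H)
          (plus (scal (- p)%C ue : H) (scal (- q)%C uf))) by vector.
      eapply Rle_trans; [apply norm_plus_le|].
      pose proof (norm_plus_le (scal (- p)%C ue) (scal (- q)%C uf)).
      pose proof (norm_scal_C (lambda - RtoC u)%C a1).
      pose proof (norm_scal_C (- p)%C ue). pose proof (norm_scal_C (- q)%C uf).
      rewrite Cmod_opp in *. pose proof (norm_ge_0 uf). nra. }
    pose proof (norm_ge_0 a1).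
    assert (N3 : c / 2 * norm a1 <= Cmod p * (c * K1 + norm ue + norm uf)) by nra.
    apply Rmult_le_reg_l with (c / 2); [lra|].
    replace (c / 2 * (K * Cmod p)) with (Cmod p * (c * K1 + norm ue + norm uf))
      by (unfold K; field; lra). exact N3. }
  set (X := norm (fst a)) in *. set (P := Cmod (Gp a)) in *.
  assert (0 <= X) by apply norm_ge_0.
  apply Rmult_le_reg_r with (P ^ 2); [nra|]. rewrite E1.
  assert (X * X <= (K * P) * (K * P)) by (apply Rmult_le_compat; trivial).
  nra.
Qed.
End Triplet.

(** The matrix of boundary values of one triplet on a boundary basis of the other
    is invertible because its image contains two independent vectors. *)
Lemma weyl_mobius Gp Gm Gp' Gm' B M :
  boundary_triplet T Gp Gm -> boundary_triplet T Gp' Gm' ->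
  contractive_weyl_function T Gp' Gm' B -> weyl_function T Gp Gm M ->
  exists al be ga de : C, (al * de - be * ga)%C <> RtoC 0 /\
    forall lambda, 0 < Im lambda ->
      (M lambda * (ga * B lambda + de))%C = (al * B lambda + be)%C.
Proof.
  intros HG HG' HB HM.
  destruct (triplet_decomposition Gp' Gm' HG') as [e [f [He [Hf Hdec]]]].
  destruct (triplet_linear_p T Gp Gm HG) as [Lp Sp].
  destruct (triplet_linear_m T Gp Gm HG) as [Lm Sm].
  assert (s2 : RtoC (sqrt 2) <> RtoC 0).
  { intros E. apply RtoC_inj in E. now apply sqrt2_neq_0. }
  set (g0 := Gamma0 Gp Gm). set (g1 := Gamma1 Gp Gm).
  assert (Hlin : forall a, graph_orth T a ->
    g0 a = (Gp' a * g0 e + Gm' a * g0 f)%C /\ g1 a = (Gp' a * g1 e + Gm' a * g1 f)%C).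
  { intros a Ha. destruct (Hdec a Ha) as [t [Gt Ea]].
    destruct (triplet_vanish T Gp Gm HG t Gt) as [Vp Vm].
    pose proof (graph_in_orth (entire_symmetric T HT) t Gt) as Ot.
    assert (He' : forall c, graph_orth T (scal c e)) by (intros; now apply graph_orth_scal).
    assert (Hf' : forall c, graph_orth T (scal c f)) by (intros; now apply graph_orth_scal).
    assert (Ep : Gp a = (Gp' a * Gp e + Gm' a * Gp f)%C).
    { rewrite Ea at 1. rewrite !Lp, !Sp, Vp by (trivial; now apply graph_orth_plus).
      change (Gp' a * Gp e + Gm' a * Gp f + RtoC 0 = Gp' a * Gp e + Gm' a * Gp f)%C. ring. }
    assert (Em : Gm a = (Gp' a * Gm e + Gm' a * Gm f)%C).
    { rewrite Ea at 1. rewrite !Lm, !Sm, Vm by (trivial; now apply graph_orth_plus).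
      change (Gp' a * Gm e + Gm' a * Gm f + RtoC 0 = Gp' a * Gm e + Gm' a * Gm f)%C. ring. }
    unfold g0, g1, Gamma0, Gamma1. rewrite Ep, Em.
    split; field; auto using Ci_nz. }
  exists (g1 f), (g1 e), (g0 f), (g0 e). split.
  (* [x] and [y] have [(Gamma_0, Gamma_1)] on the two coordinate axes. *)
  - destruct (triplet_surj T Gp Gm HG (RtoC 1) (RtoC 1)) as [x [Hx [Xp Xm]]].
    destruct (triplet_surj T Gp Gm HG (RtoC 1) (- RtoC 1)%C) as [y [Hy [Yp Ym]]].
    destruct (Hlin x Hx) as [X0 X1]. destruct (Hlin y Hy) as [Y0 Y1].
    assert (X0' : g0 x = RtoC 0) by (unfold g0, Gamma0; rewrite Xp, Xm; field; auto using Ci_nz).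
    assert (Y1' : g1 y = RtoC 0) by (unfold g1, Gamma1; rewrite Yp, Ym; field; auto).
    assert (X1' : g1 x <> RtoC 0).
    { unfold g1, Gamma1. rewrite Xp, Xm. intros E.
      apply (f_equal (fun z => z * RtoC (sqrt 2))%C) in E.
      replace ((RtoC 1 + RtoC 1) / RtoC (sqrt 2) * RtoC (sqrt 2))%C with (RtoC 1 + RtoC 1)%C in E
        by (field; auto).
      apply (f_equal fst) in E. simpl in E. lra. }
    assert (Y0' : g0 y <> RtoC 0).
    { unfold g0, Gamma0. rewrite Yp, Ym. intros E.
      apply (f_equal (fun z => z * (Ci * RtoC (sqrt 2)))%C) in E.
      replace ((RtoC 1 - - RtoC 1) / (Ci * RtoC (sqrt 2)) * (Ci * RtoC (sqrt 2)))%C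
        with (RtoC 1 + RtoC 1)%C in E by (field; auto using Ci_nz).
      apply (f_equal fst) in E. simpl in E. lra. }
    intros D.
    assert (E : (g1 x * g0 y)%C = RtoC 0); [|now apply (Cmult_neq_0 _ _ X1' Y0')].
    transitivity (g1 x * g0 y - g0 x * g1 y)%C; [rewrite X0'; ring|].
    rewrite X0, X1, Y0, Y1.
    transitivity ((g1 f * g0 e - g1 e * g0 f) * (Gm' x * Gp' y - Gp' x * Gm' y))%C; [ring|].
    rewrite D. ring.
  - intros lambda Hl.
    destruct (weyl_vector_Gp Gp' Gm' HG' B lambda HB Hl) as [a [Ha [_ Hp]]].
    destruct (Hlin a (proj1 Ha)) as [A0 A1].
    pose proof (proj2 HM lambda a Hl Ha) as E. fold g0 g1 in E.
    change (g1 a = (M lambda * g0 a)%C) in E.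
    rewrite A0, A1, (proj2 HB lambda a Hl Ha) in E.
    transitivity (/ Gp' a * (M lambda * (Gp' a * g0 e + B lambda * Gp' a * g0 f)))%C;
      [field; trivial|].
    rewrite <- E. field. trivial.
Qed.
End Ops.

(** * The contractive Weyl function at a real point *)

Lemma upper_point (x y : R) : (RtoC x + Ci * RtoC y)%C = (x, y).
Proof. apply injective_projections; simpl; ring. Qed.

Lemma Cmod_upper_point (x y : R) : 0 <= y -> Cmod (RtoC x + Ci * RtoC y - RtoC x)%C = y.
Proof.
  intros Hy. replace (RtoC x + Ci * RtoC y - RtoC x)%C with (Ci * RtoC y)%C by ring.
  rewrite Cmod_mult, Cmod_Ci, Cmod_R, Rabs_pos_eq; lra.
Qed.

(** At a pole of order [n + 1], the numerator at [u + i y] is at most [K y], so it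
    would vanish at [u]. *)
Lemma bounded_not_pole B (u : R) r K :
  0 < r -> (forall y, 0 < y < r -> Cmod (B (RtoC u + Ci * RtoC y)%C) <= K) ->
  ~ is_pole B (RtoC u).
Proof.
  intros Hr H (n & g & Hn & Hg & Hg0 & Hloc).
  destruct n as [|n]; [lia|].
  unfold locally', within in Hloc. apply locally_Cmod in Hloc as [r1 [Hr1 Hloc]].
  apply Cmod_gt_0 in Hg0.
  destruct (analytic_continuous g (RtoC u) (Cmod (g (RtoC u)) / 2) Hg ltac:(lra)) as [r2 [Hr2 Hc]].
  set (K' := Rabs K + 1).
  assert (HK' : 0 < K') by (pose proof (Rabs_pos K); unfold K'; lra).
  set (y := Rmin (Rmin (r / 2) (r1 / 2)) (Rmin (Rmin (r2 / 2) 1) (Cmod (g (RtoC u)) / 2 / K'))).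
  assert (Hy : 0 < y) by (repeat apply Rmin_pos; try apply Rdiv_lt_0_compat; lra).
  assert (y <= r / 2) by (eapply Rle_trans; [apply Rmin_l | apply Rmin_l]).
  assert (y <= r1 / 2) by (eapply Rle_trans; [apply Rmin_l | apply Rmin_r]).
  assert (y <= r2 / 2)
    by (eapply Rle_trans; [apply Rmin_r | eapply Rle_trans; [apply Rmin_l | apply Rmin_l]]).
  assert (y <= 1)
    by (eapply Rle_trans; [apply Rmin_r | eapply Rle_trans; [apply Rmin_l | apply Rmin_r]]).
  assert (Hyg : y <= Cmod (g (RtoC u)) / 2 / K')
    by (eapply Rle_trans; [apply Rmin_r | apply Rmin_r]).
  apply Rle_div_r in Hyg; [|exact HK'].
  clearbody y.
  set (z := (RtoC u + Ci * RtoC y)%C).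
  assert (Hz : Cmod (z - RtoC u) = y) by (apply Cmod_upper_point; lra).
  assert (Hne : (z - RtoC u)%C <> RtoC 0) by (apply Cmod_gt_0; lra).
  assert (HB : B z = (g z / (z - RtoC u) ^ S n)%C).
  { apply Hloc; [lra|]. intros E. apply Hne. rewrite E. ring. }
  specialize (Hc z ltac:(lra)). specialize (H y ltac:(lra)). fold z in H.
  assert (Hgz : g z = (B z * (z - RtoC u) ^ S n)%C)
    by (rewrite HB; field; now apply Cpow_nz).
  assert (Hgz1 : Cmod (g z) <= K' * y).
  { rewrite Hgz, Cmod_mult, Cmod_pow, Hz.
    apply Rmult_le_compat; [apply Cmod_ge_0 | apply pow_le; lra | |].
    - pose proof (Rle_abs K). unfold K'. lra.
    - simpl. assert (y ^ n <= 1) by (rewrite <- (pow1 n); apply pow_incr; lra). nra. }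
  assert (Hgu : Cmod (g (RtoC u)) <= Cmod (g z) + Cmod (g z - g (RtoC u))).
  { replace (g (RtoC u)) with (g z + - (g z - g (RtoC u)))%C at 1 by ring.
    eapply Rle_trans; [apply Cmod_triangle|]. rewrite Cmod_opp. lra. }
  lra.
Qed.

Section Boundary.
Context (B : C -> C) (u r K c : R).
Context (Hr : 0 < r) (Hc : 0 < c).
Context (Hup : forall z, 0 < Im z -> Cmod (z - RtoC u) < r -> 0 <= 1 - Cmod (B z) ^ 2 <= K * Im z).
Context (Hlow : forall z, 0 < Im z -> Cmod (z - RtoC u) < r -> c * Im z <= 1 - Cmod (B z) ^ 2).
Context (HB : analytic_at B (RtoC u)).

(** Only the two-sided bound in the upper half-plane is known; it is transported
    to each nearby real point by continuity of [B]. *)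
Lemma boundary_unimodular :
  exists r', 0 < r' /\ forall x, Rabs (x - u) < r' -> Cmod (B (RtoC x)) = 1.
Proof.
  destruct (analytic_derive _ _ HB) as [_ [r1 [Hr1 Hd]]].
  exists (Rmin r1 (r / 2)). split; [apply Rmin_pos; lra|].
  intros x Hx. pose proof (Rmin_l r1 (r / 2)). pose proof (Rmin_r r1 (r / 2)).
  assert (Hxu : Cmod (RtoC x - RtoC u) = Rabs (x - u)) by (rewrite <- RtoC_minus; apply Cmod_R).
  assert (App : forall eps, 0 < eps -> Rabs (Cmod (B (RtoC x)) - 1) <= eps).
  { intros eps He.
    destruct (cderive_continuous B (RtoC x) _ (eps / 2) (Hd (RtoC x) ltac:(lra)) ltac:(lra))
      as [d [Hd0 HdB]].
    set (K' := Rabs K + 1).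
    assert (HK' : 0 < K') by (pose proof (Rabs_pos K); unfold K'; lra).
    set (y := Rmin (d / 2) (Rmin (r / 4) (eps / 2 / K'))).
    assert (Hy : 0 < y) by (repeat apply Rmin_pos; repeat apply Rdiv_lt_0_compat; lra).
    assert (y <= d / 2) by apply Rmin_l.
    assert (y <= r / 4) by (eapply Rle_trans; [apply Rmin_r | apply Rmin_l]).
    assert (Hy2 : y <= eps / 2 / K') by (eapply Rle_trans; [apply Rmin_r | apply Rmin_r]).
    apply Rle_div_r in Hy2; [|exact HK']. clearbody y.
    set (z := (RtoC x + Ci * RtoC y)%C).
    assert (Hz : Cmod (z - RtoC x) = y) by (apply Cmod_upper_point; lra).
    assert (Hzu : Cmod (z - RtoC u) < r).
    { replace (z - RtoC u)%C with ((z - RtoC x) + (RtoC x - RtoC u))%C by ring.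
      eapply Rle_lt_trans; [apply Cmod_triangle|]. lra. }
    assert (Hi : Im z = y) by (unfold z; rewrite upper_point; reflexivity).
    destruct (Hup z ltac:(lra) Hzu) as [HH1 HH2]. rewrite Hi in HH2.
    specialize (HdB z ltac:(lra)).
    assert (HH3 : Rabs (Cmod (B z) - Cmod (B (RtoC x))) < eps / 2).
    { eapply Rle_lt_trans; [|exact HdB]. apply Rabs_le. split.
      - assert (Cmod (B (RtoC x)) <= Cmod (B z) + Cmod (B z - B (RtoC x))); [|lra].
        replace (B (RtoC x)) with (B z + - (B z - B (RtoC x)))%C at 1 by ring.
        eapply Rle_trans; [apply Cmod_triangle|]. rewrite Cmod_opp. lra.
      - assert (Cmod (B z) <= Cmod (B z - B (RtoC x)) + Cmod (B (RtoC x))); [|lra].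
        replace (B z) with ((B z - B (RtoC x)) + B (RtoC x))%C at 1 by ring.
        apply Cmod_triangle. }
    pose proof (Cmod_ge_0 (B z)) as HH4. pose proof (Rle_abs K).
    assert (HH5 : Cmod (B z) <= 1) by nra.
    assert (HH6 : 1 - eps / 2 <= Cmod (B z)) by (unfold K' in Hy2; nra).
    apply Rabs_def2 in HH3. apply Rabs_le. lra. }
  assert (Rabs (Cmod (B (RtoC x)) - 1) <= 0).
  { apply le_epsilon. intros eps He. rewrite Rplus_0_l. now apply App. }
  pose proof (Rabs_pos (Cmod (B (RtoC x)) - 1)).
  assert (E : Rabs (Cmod (B (RtoC x)) - 1) = 0) by lra.
  destruct (Req_dec (Cmod (B (RtoC x)) - 1) 0) as [E'|E']; [lra|].
  apply Rabs_no_R0 in E'. lra.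
Qed.

(** If the derivative vanished, [1 - |B(u + i y)|^2] would be of order [y^2],
    against the linear lower bound. *)
Lemma boundary_derivative_nonzero : C_derive B (RtoC u) <> RtoC 0.
Proof.
  intros H0. destruct boundary_unimodular as [r1 [Hr1 HH1]].
  specialize (HH1 u). rewrite Rminus_diag, Rabs_R0 in HH1. specialize (HH1 Hr1).
  apply analytic_expansion in HB as [a [ra Ha]].
  destruct (expansion_derive _ _ _ _ Ha) as [rd [Hd _]].
  rewrite (expansion_value _ _ _ _ Hd) in H0. unfold dcoef in H0.
  rewrite (expansion_value _ _ _ _ Ha) in HH1.
  assert (Ha1 : a 1%nat = RtoC 0) by (rewrite <- H0; simpl (INR 1); ring).
  destruct (expansion_divide _ _ _ _ Ha) as [g [Hg Eg]].
  destruct (expansion_divide _ _ _ _ Hg) as [h [Hh Eh]].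
  destruct (expansion_bounded _ _ _ _ Hh) as [rh [L [Hrh HL]]].
  set (L' := Rabs L + 1).
  assert (HL' : 0 < L') by (pose proof (Rabs_pos L); unfold L'; lra).
  set (y := Rmin (Rmin (r / 2) (rh / 2)) (c / 4 / L')).
  assert (Hy : 0 < y) by (repeat apply Rmin_pos; repeat apply Rdiv_lt_0_compat; lra).
  assert (y <= r / 2) by (eapply Rle_trans; [apply Rmin_l | apply Rmin_l]).
  assert (y <= rh / 2) by (eapply Rle_trans; [apply Rmin_l | apply Rmin_r]).
  assert (Hy2 : y <= c / 4 / L') by apply Rmin_r.
  apply Rle_div_r in Hy2; [|exact HL']. clearbody y.
  set (z := (RtoC u + Ci * RtoC y)%C).
  assert (Hz : Cmod (z - RtoC u) = y) by (apply Cmod_upper_point; lra).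
  assert (Hi : Im z = y) by (unfold z; rewrite upper_point; reflexivity).
  pose proof (Hlow z ltac:(lra) ltac:(lra)) as HLow. rewrite Hi in HLow.
  assert (HBz : a 0%nat = (B z + - ((z - RtoC u) * (z - RtoC u) * h z))%C)
    by (rewrite Eg, Eh, Ha1; ring).
  assert (HH2 : 1 <= Cmod (B z) + y * y * L').
  { rewrite <- HH1, HBz. eapply Rle_trans; [apply Cmod_triangle|].
    rewrite Cmod_opp, !Cmod_mult, Hz. specialize (HL z ltac:(lra)).
    pose proof (Rle_abs L). unfold L'. nra. }
  pose proof (Cmod_ge_0 (B z)).
  assert (Cmod (B z) <= 1) by nra.
  assert (y * y * L' <= y * (c / 4)) by nra. nra.
Qed.
End Boundary.

(** * The Weyl function near a real point *)

Section Mobius.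
Context (B M : C -> C) (al be ga de : C) (u : R).
Context (HD : (al * de - be * ga)%C <> RtoC 0).
Context (HMB : forall lambda, 0 < Im lambda ->
  (M lambda * (ga * B lambda + de))%C = (al * B lambda + be)%C).
Context (HB : analytic_at B (RtoC u)).

(** Numerator and denominator of a nondegenerate Moebius transform have no common
    zero. *)
Lemma mobius_denominator b m : (m * (ga * b + de))%C = (al * b + be)%C -> (ga * b + de)%C <> RtoC 0.
Proof.
  intros E E0. rewrite E0, Cmult_0_r in E. apply HD.
  transitivity (al * (ga * b + de) - ga * (al * b + be))%C; [ring|].
  rewrite E0, <- E. ring.
Qed.

Lemma analytic_mobius_num p q : analytic_at (fun z => p * B z + q)%C (RtoC u).
Proof.
  apply (analytic_plus (fun z => p * B z)%C (fun _ => q)); [|apply analytic_const].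
  apply (analytic_mult (fun _ => p)); [apply analytic_const | exact HB].
Qed.

Lemma mobius_regular :
  analytic_at M (RtoC u) ->
  exists r, 0 < r /\ forall z, Cmod (z - RtoC u) < r ->
    (M z * (ga * B z + de))%C = (al * B z + be)%C.
Proof.
  intros HM.
  destruct (analytic_identity (fun z => M z * (ga * B z + de) + (- RtoC 1) * (al * B z + be))%C
    (RtoC u) Ci 1) as [r [Hr H]].
  - apply (analytic_plus (fun z => M z * (ga * B z + de))%C).
    + exact (analytic_mult M _ _ HM (analytic_mobius_num ga de)).
    + exact (analytic_mult (fun _ => - RtoC 1)%C _ _ (analytic_const _ _)
        (analytic_mobius_num al be)).
  - exact Ci_nz.
  - lra.
  - intros t Ht. rewrite Cmult_comm with (x := RtoC t). rewrite HMB; [ring|].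
    rewrite upper_point. simpl. lra.
  - exists r. split; trivial. intros z Hz. specialize (H z Hz).
    transitivity ((M z * (ga * B z + de) + - RtoC 1 * (al * B z + be)) + (al * B z + be))%C;
      [ring|].
    rewrite H. ring.
Qed.

(** Clearing the power of [z - u] gives an identity between functions analytic at
    [u]. *)
Lemma mobius_at_pole :
  is_pole M (RtoC u) ->
  exists r, 0 < r /\ forall z, Cmod (z - RtoC u) < r -> z <> RtoC u ->
    (M z * (ga * B z + de))%C = (al * B z + be)%C.
Proof.
  intros (n & g & _ & Hg & _ & Hloc).
  unfold locally', within in Hloc. apply locally_Cmod in Hloc as [r1 [Hr1 Hloc]].
  destruct (analytic_identity
    (fun z => g z * (ga * B z + de) + (- RtoC 1) * ((z - RtoC u) ^ n * (al * B z + be)))%C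
    (RtoC u) Ci r1) as [r [Hr H]].
  - apply (analytic_plus (fun z => g z * (ga * B z + de))%C).
    + exact (analytic_mult g _ _ Hg (analytic_mobius_num ga de)).
    + exact (analytic_mult (fun _ => - RtoC 1)%C _ _ (analytic_const _ _)
        (analytic_mult _ _ _ (analytic_power (RtoC u) n) (analytic_mobius_num al be))).
  - exact Ci_nz.
  - exact Hr1.
  - intros t Ht. rewrite Cmult_comm with (x := RtoC t).
    set (z := (RtoC u + Ci * RtoC t)%C).
    assert (Hz : Cmod (z - RtoC u) = t) by (apply Cmod_upper_point; lra).
    assert (Hne : (z - RtoC u)%C <> RtoC 0) by (apply Cmod_gt_0; lra).
    assert (Hi : 0 < Im z) by (unfold z; rewrite upper_point; simpl; lra).
    rewrite <- (HMB z Hi), (Hloc z); [field; now apply Cpow_nz | lra |].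
    intros E. apply Hne. rewrite E. ring.
  - exists (Rmin r r1). split; [now apply Rmin_pos|]. intros z Hz Hne.
    pose proof (Rmin_l r r1). pose proof (Rmin_r r r1).
    specialize (H z ltac:(lra)). rewrite (Hloc z) by (trivial; lra).
    assert (Hnz : (z - RtoC u)%C <> RtoC 0) by now apply Cminus_eq_contra.
    assert (Hp : ((z - RtoC u) ^ n)%C <> RtoC 0) by now apply Cpow_nz.
    transitivity (/ (z - RtoC u) ^ n * (g z * (ga * B z + de) +
      - RtoC 1 * ((z - RtoC u) ^ n * (al * B z + be))) + (al * B z + be))%C; [field; trivial|].
    rewrite H. ring.
Qed.
End Mobius.

(** * The curvature function on the real line *)

(** On the vertical line through [u] only the terms with no power of the
    horizontal increment survive, which leaves a real power series in [y]. *)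
Lemma real_analytic_vertical omega (u : R) :
  real_analytic omega ->
  filterlim (fun y => omega (RtoC u + Ci * RtoC y)%C) (at_right 0) (locally (omega (RtoC u))).
Proof.
  intros Hom. destruct (Hom (RtoC u)) as (a & r & Hr & H).
  assert (Hs : forall k, Rabs k < r -> is_pseries (a 0%nat) k (omega (u, k))).
  { intros k Hk. destruct (H 0 k) as [_ Hk2]; [now rewrite Rabs_R0 | trivial |].
    simpl in Hk2. rewrite Rplus_0_r, Rplus_0_l in Hk2.
    revert Hk2. apply is_series_ext. intros n.
    assert (E : forall m N, sum_n (fun i => a i (N - i)%nat * 0 ^ i * k ^ (N - i)) m =
       a 0%nat N * k ^ N).
    { intros m N. induction m as [|m IH].
      - rewrite sum_O. simpl. rewrite Nat.sub_0_r. ring.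
      - rewrite sum_Sn, IH.
        change (a 0%nat N * k ^ N + a (S m) (N - S m)%nat * (0 * 0 ^ m) * k ^ (N - S m) =
          a 0%nat N * k ^ N). ring. }
    transitivity (a 0%nat n * k ^ n); [exact (E n n)|].
    rewrite <- (pow_n_pow k n). apply Rmult_comm. }
  assert (Hrad : Rbar_lt (Rabs 0) (CV_radius (a 0%nat))).
  { apply Rbar_not_le_lt. intros Hle.
    apply (CV_disk_outside (a 0%nat) (r / 2)).
    - eapply Rbar_le_lt_trans; [exact Hle|]. simpl. rewrite Rabs_R0, Rabs_pos_eq; lra.
    - apply ex_series_lim_0. exists (omega (u, r / 2)).
      generalize (Hs (r / 2) ltac:(rewrite Rabs_pos_eq; lra)). apply is_series_ext.
      intros n. rewrite <- (pow_n_pow (r / 2) n). apply Rmult_comm. }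
  pose proof (PSeries_continuity _ _ Hrad) as Hc.
  apply continuity_pt_filterlim in Hc.
  assert (E0 : forall k, Rabs k < r -> PSeries (a 0%nat) k = omega (u, k)).
  { intros k Hk. apply is_pseries_unique. now apply Hs. }
  rewrite E0 in Hc by now rewrite Rabs_R0.
  apply filterlim_ext_loc with (f := PSeries (a 0%nat)).
  - exists (mkposreal r Hr). intros y Hy _. rewrite upper_point. apply E0.
    change (Rabs (y - 0) < r) in Hy. now rewrite Rminus_0_r in Hy.
  - change (RtoC u) with (u, 0). revert Hc. apply filterlim_filter_le_1.
    intros P. unfold at_right, within. apply filter_imp. auto.
Qed.

Theorem proposition3p10
  (H : HilbertSpace) (Hsep : separable H) (Hinf : infinite_dimensional H)
  (T : operator H) (HT : entire_1_1 T)
  (omega : C -> R) (Homega : curvature_function T omega)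
  (Gp Gm : H * H -> C) (HG : boundary_triplet T Gp Gm)
  (M : C -> C) (HM : weyl_function T Gp Gm M)
  (u : R) :
  (~ is_pole M (RtoC u) ->
     RtoC (omega (RtoC u)) = (/ RtoC 6 * schwarzian M (RtoC u))%C) /\
  (is_pole M (RtoC u) ->
     exists s : C,
       filterlim (schwarzian M) (locally' (RtoC u)) (locally s) /\
       RtoC (omega (RtoC u)) = (/ RtoC 6 * s)%C).
Proof.
  destruct Homega as (Hra & _ & Gp' & Gm' & B & HG' & HB & Hform).
  destruct (contractive_upper_bound T HT Gp' Gm' HG' B u HB) as (r1 & K & Hr1 & Hup).
  destruct (contractive_lower_bound T HT Gp' Gm' HG' B u HB) as (c & Hc & Hlow).
  assert (HBu : analytic_at B (RtoC u)).
  { destruct (proj1 HB (RtoC u)) as [Han|Hpole]; trivial. exfalso. revert Hpole.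
    apply (bounded_not_pole B u r1 1 Hr1). intros y Hy.
    assert (Hi : 0 < Im (RtoC u + Ci * RtoC y)%C) by (rewrite upper_point; simpl; lra).
    assert (Hz : Cmod (RtoC u + Ci * RtoC y - RtoC u)%C = y) by (apply Cmod_upper_point; lra).
    destruct (Hup _ Hi ltac:(lra)) as [H1 _].
    pose proof (Cmod_ge_0 (B (RtoC u + Ci * RtoC y)%C)). nra. }
  set (r := Rmin r1 1).
  assert (Hr : 0 < r) by (apply Rmin_pos; lra).
  assert (Hrr1 : r <= r1) by apply Rmin_l. assert (Hrl : r <= 1) by apply Rmin_r.
  assert (Hup' : forall z, 0 < Im z -> Cmod (z - RtoC u) < r ->
    0 <= 1 - Cmod (B z) ^ 2 <= K * Im z) by (intros z H1 H2; apply Hup; lra).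
  assert (Hlow' : forall z, 0 < Im z -> Cmod (z - RtoC u) < r ->
    c * Im z <= 1 - Cmod (B z) ^ 2) by (intros z H1 H2; apply Hlow; lra).
  destruct (boundary_unimodular B u r K Hr Hup' HBu) as (r2 & Hr2 & Hunit).
  pose proof (boundary_derivative_nonzero B u r K c Hr Hc Hup' Hlow' HBu) as Hd.
  destruct (curvature_limit B u r2 HBu Hd Hr2) as (l & El & Hl).
  { intros x Hx. apply Hunit. rewrite Rabs_pos_eq; lra. }
  assert (Eom : omega (RtoC u) = l).
  { apply (filterlim_locally_unique (K := R_AbsRing) (V := R_NormedModule) (F := at_right 0)
      (fun y => omega (RtoC u + Ci * RtoC y)%C)).
    - apply real_analytic_vertical, Hra.
    - revert Hl. apply filterlim_ext_loc.
      exists (mkposreal 1 Rlt_0_1). intros y _ Hy.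
      assert (Hi : Im (RtoC u + Ci * RtoC y)%C = y) by (rewrite upper_point; reflexivity).
      rewrite Hform by lra. now rewrite Hi. }
  (* It remains to compare the Schwarzian derivatives of [B] and [M]. *)
  rewrite Eom, El.
  destruct (weyl_mobius T HT Gp Gm Gp' Gm' B M HG HG' HB HM) as (al & be & ga & de & HD & HMB).
  destruct (analytic_regular_near B (RtoC u) HBu Hd) as (r3 & Hr3 & Hreg).
  assert (HS : forall z r4, 0 < r4 -> (forall w, Cmod (w - z) < r4 -> Cmod (w - RtoC u) < r3 /\
      (M w * (ga * B w + de))%C = (al * B w + be)%C) ->
    schwarzian M z = (C_derive (C_derive (C_derive B)) z / C_derive B z -
      RtoC 3 / RtoC 2 * (C_derive (C_derive B) z / C_derive B z *
                         (C_derive (C_derive B) z / C_derive B z)))%C).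
  { intros z r4 Hr4 Hw.
    apply (schwarzian_mobius B M _ _ _ al be ga de z r4 Hr4 HD).
    intros w Hwz. destruct (Hw w Hwz) as [Hwu E].
    destruct (Hreg w Hwu) as (D1 & D2 & D3 & Hn).
    pose proof (mobius_denominator al be ga de HD _ _ E) as Hden.
    split; [exact D1|]. split; [exact D2|]. split; [exact D3|].
    split; [exact Hn|]. split; [exact Hden|].
    rewrite <- E. field. exact Hden. }
  split.
  - intros Hnp. assert (HMu : analytic_at M (RtoC u)).
    { destruct (proj1 HM (RtoC u)) as [Han|Hp]; [exact Han | contradiction]. }
    destruct (mobius_regular B M al be ga de u HMB HBu HMu) as (r4 & Hr4 & Heq).
    rewrite (schwarzian_value B (RtoC u) r3 Hr3 Hreg).
    rewrite (HS (RtoC u) (Rmin r3 r4)); trivial.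
    + now apply Rmin_pos.
    + intros w Hw. pose proof (Rmin_l r3 r4). pose proof (Rmin_r r3 r4).
      split; [lra | apply Heq; lra].
  - intros Hp. exists (schwarzian B (RtoC u)). split; trivial.
    destruct (mobius_at_pole B M al be ga de u HMB HBu Hp) as (r4 & Hr4 & Heq).
    rewrite (schwarzian_value B (RtoC u) r3 Hr3 Hreg).
    set (Phi := fun z => (C_derive (C_derive (C_derive B)) z / C_derive B z -
      RtoC 3 / RtoC 2 * (C_derive (C_derive B) z / C_derive B z *
                         (C_derive (C_derive B) z / C_derive B z)))%C).
    change (filterlim (schwarzian M) (locally' (RtoC u)) (locally (Phi (RtoC u)))).
    destruct (analytic_derive _ _ HBu) as [A1 _]. destruct (analytic_derive _ _ A1) as [A2 _].
    destruct (analytic_derive _ _ A2) as [A3 _].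
    destruct (analytic_derive _ _ A3) as [_ [r5 [Hr5 D4]]].
    destruct (Hreg (RtoC u) (Cmod_near_refl _ _ Hr3)) as (_ & D2 & D3 & Hn).
    specialize (D4 (RtoC u) (Cmod_near_refl _ _ Hr5)).
    assert (HPhi : exists d, cderive Phi (RtoC u) d).
    { eexists. apply (cderive_ext_near (fun z => C_derive (C_derive (C_derive B)) z / C_derive B z +
        (- (RtoC 3 / RtoC 2)) * (C_derive (C_derive B) z / C_derive B z *
                         (C_derive (C_derive B) z / C_derive B z)))%C _ _ _ 1); [lra | |].
      - intros w _. unfold Phi. ring.
      - apply (cderive_plus (fun z => C_derive (C_derive (C_derive B)) z / C_derive B z)%C).
        + exact (cderive_div _ _ _ _ _ D4 D2 Hn).
        + apply (cderive_mult (fun _ => (- (RtoC 3 / RtoC 2))%C)); [apply cderive_const|].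
          apply (cderive_mult (fun z => C_derive (C_derive B) z / C_derive B z)%C);
            exact (cderive_div _ _ _ _ _ D3 D2 Hn). }
    destruct HPhi as [d HPhi].
    intros P HP. apply locally_Cmod in HP as (eps & Heps & HP).
    destruct (cderive_continuous Phi (RtoC u) d eps HPhi Heps) as (r6 & Hr6 & Hcont).
    unfold filtermap, locally', within. apply locally_Cmod.
    exists (Rmin (Rmin r3 r4) r6). split; [repeat apply Rmin_pos; trivial|].
    intros z Hz Hzu.
    pose proof (Rmin_l (Rmin r3 r4) r6). pose proof (Rmin_r (Rmin r3 r4) r6).
    pose proof (Rmin_l r3 r4). pose proof (Rmin_r r3 r4).
    apply HP.
    assert (Hpos : 0 < Cmod (z - RtoC u)) by now apply Cmod_gt_0, Cminus_eq_contra.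
    (* The disc around [z] must avoid [u], where [M] is not controlled. *)
    rewrite (HS z (Rmin (Cmod (z - RtoC u)) (Rmin r3 r4 - Cmod (z - RtoC u)))).
    + apply Hcont. lra.
    + apply Rmin_pos; lra.
    + intros w Hw.
      pose proof (Rmin_l (Cmod (z - RtoC u)) (Rmin r3 r4 - Cmod (z - RtoC u))).
      pose proof (Rmin_r (Cmod (z - RtoC u)) (Rmin r3 r4 - Cmod (z - RtoC u))).
      assert (Hwu : Cmod (w - RtoC u) < Rmin r3 r4)
        by (apply (Cmod_near_trans (RtoC u) z w); lra).
      split; [lra|]. apply Heq; [lra|]. intros E. subst w.
      replace (RtoC u - z)%C with (- (z - RtoC u))%C in Hw by ring.
      rewrite Cmod_opp in Hw. lra.
Qed.
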